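(* Let $(\mathfrak M_1,\Omega_1)$ and $(\mathfrak M_2,\Omega_2)$ be probability spaces in standard form on Hilbert spaces $\mathcal H_1,\mathcal H_2$, with modular conjugations $J_1,J_2$. Let $\Phi:(\mathfrak M_1,\Omega_1)\to(\mathfrak M_2,\Omega_2)$ be a preserving Markov operator with adjoint $\Phi^\sharp:(\mathfrak M_2,\Omega_2)\to(\mathfrak M_1,\Omega_1)$, and let $\mathcal L_{\Phi^\sharp}$, $\sigma_{\Phi^\sharp}$, $\tau_{\Phi^\sharp}$, $V_{\Phi^\sharp}$, $\Lambda_{\Phi^\sharp}$, $\Omega_{\Phi^\sharp}$ be the associated Stinespring data (defined in the context). Let $\widehat J:\mathcal L_{\Phi^\sharp}\to\mathcal L_{\Phi^\sharp}$ be an anti-unitary operator with $$\widehat J\,V_{\Phi^\sharp}=V_{\Phi^\sharp}J_1,$$ and let $\mathfrak R\subset\mathfrak B(\mathcal L_{\Phi^\sharp})$ be the von Neumann algebra generated by $\sigma_{\Phi^\sharp}(\mathfrak M_2)$ and $\widehat J^*\,\tau_{\Phi^\sharp}(\mathfrak M_1')\,\widehat J$. If $$V_{\Phi^\sharp}^*\,\mathfrak R\,V_{\Phi^\sharp}\subset\mathfrak M_1\qquad\text{and}\qquad \Lambda_{\Phi^\sharp}^*\,\mathfrak R\,\Lambda_{\Phi^\sharp}\subset\mathfrak M_2,$$ then $(\mathfrak R,\Omega_{\Phi^\sharp})$ is standard in $\mathcal L_{\Phi^\sharp}$ (that is, $\Omega_{\Phi^\sharp}$ is cyclic and separating for $\mathfrak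 R$) and $\Phi$ is factorizable.
   Context: Inner products are linear in the second variable. $\mathfrak B(\mathcal H)$ denotes the bounded operators on $\mathcal H$ and $\mathfrak M'$ the commutant of $\mathfrak M$. A probability space is a von Neumann algebra with a normal faithful state. It is in standard form, written $(\mathfrak M,\Omega)$, if $\mathfrak M\subset\mathfrak B(\mathcal H)$ is a concrete von Neumann algebra, $\Omega\in\mathcal H$ is a cyclic and separating unit vector for $\mathfrak M$, and the state is $A\mapsto\langle\Omega,A\Omega\rangle$. $J_i$ is the Tomita modular conjugation of $(\mathfrak M_i,\Omega_i)$. A stochastic map $\Phi:(\mathfrak M_1,\varphi_1)\to(\mathfrak M_2,\varphi_2)$ between probability spaces is a normal unital completely positive map $\mathfrak M_1\to\mathfrak M_2$ with $\varphi_2\circ\Phi=\varphi_1$. It admits an adjoint if there is a stochastic map $\Phi^\sharp:(\mathfrak M_2,\varphi_2)\to(\mathfrak M_1,\varphi_1)$ with $\varphi_2(B\,\Phi(A))=\varphi_1(\Phi^\sharp(B)\,A)$ for all $A\in\mathfrak M_1$, $B\in\mathfrak M_2$. A preserving Markov operator (or map) is a stochastic map that admits an adjoint. A stochastic map is deterministic if it is a homomorphism of von Neumann algebras. A preserving Markov operator $\Phi:(\mathfrak M_1,\varphi_1)\to(\mathfrak M_2,\varphi_2)$ is factorizable if there exist a probability space $(\mathfrak N,\omega)$ and deterministic preserving Markov operators $\alpha:(\mathfrak M_2,\varphi_2)\to(\mathfrak N,\omega)$ and $\beta:(\mathfrak M_1,\varphi_1)\to(\mathfrak N,\omega)$ with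 $\Phi=\alpha^\sharp\circ\beta$. Stinespring data of $\Phi^\sharp:\mathfrak M_2\to\mathfrak M_1$: $\mathcal L_{\Phi^\sharp}$ is the Hilbert space obtained by separation and completion of the algebraic tensor product $\mathfrak M_2\otimes\mathcal H_1$ with respect to the semi-inner product $\langle A\otimes h,X\otimes k\rangle=\langle h,\Phi^\sharp(A^*X)k\rangle$. The image of $A\otimes h$ is written $A\overline\otimes_{\Phi^\sharp}h$. The representation $\sigma_{\Phi^\sharp}:\mathfrak M_2\to\mathfrak B(\mathcal L_{\Phi^\sharp})$ is given by $\sigma_{\Phi^\sharp}(A)(X\overline\otimes_{\Phi^\sharp}h)=AX\overline\otimes_{\Phi^\sharp}h$. The representation $\tau_{\Phi^\sharp}:\mathfrak M_1'\to\mathfrak B(\mathcal L_{\Phi^\sharp})$ is given by $\tau_{\Phi^\sharp}(Y)(X\overline\otimes_{\Phi^\sharp}h)=X\overline\otimes_{\Phi^\sharp}Yh$. The isometry $V_{\Phi^\sharp}:\mathcal H_1\to\mathcal L_{\Phi^\sharp}$ is $V_{\Phi^\sharp}h=1\overline\otimes_{\Phi^\sharp}h$. The isometry $\Lambda_{\Phi^\sharp}:\mathcal H_2\to\mathcal L_{\Phi^\sharp}$ is the continuous extension of $\Lambda_{\Phi^\sharp}A\Omega_2=A\overline\otimes_{\Phi^\sharp}\Omega_1$, $A\in\mathfrak M_2$. Finally $\Omega_{\Phi^\sharp}=1\overline\otimes_{\Phi^\sharp}\Omega_1$. *)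

(* Defs.v *)
From HB Require Import structures.
From mathcomp Require Import all_boot all_order all_algebra complex.
From mathcomp Require Import boolp classical_sets functions reals.
From mathcomp Require Import topology normedtype.

Set Implicit Arguments.
Unset Strict Implicit.
Unset Printing Implicit Defensive.

Import Order.TTheory GRing.Theory Num.Theory.
Import numFieldNormedType.Exports.

Local Open Scope classical_set_scope.
Local Open Scope ring_scope.

(* Complex Hilbert spaces.  The inner product is linear in the SECOND variable;
   positivity and definiteness follow from [dotxx]. *)
HB.mixin Record CompleteNormedModule_isHilbert (R : realType) H
    & CompleteNormedModule R[i] H := {
  dot : H -> H -> R[i] ;
  dotDZr : forall (a : R[i]) (x y z : H),
    dot x (a *: y + z) = a * dot x y + dot x z ;
  dotC : forall x y : H, dot y x = (dot x y)^* ;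
  dotxx : forall x : H, dot x x = `|x| ^+ 2
}.

#[short(type="hilbertType")]
HB.structure Definition Hilbert (R : realType) :=
  {H of CompleteNormedModule_isHilbert R H & CompleteNormedModule R[i] H}.

Section Operators.
Variable R : realType.
Implicit Types H K : hilbertType R.

Definition bounded_operator H K (T : H -> K) : Prop :=
  linear T /\ exists c : R[i], forall x, `|T x| <= c * `|x|.

(* The defining relation has exactly one solution when T is bounded. *)
Definition adj H K (T : H -> K) : K -> H :=
  get [set S : K -> H | forall x y, dot (T x) y = dot x (S y)].

Definition antiunitary H K (J : H -> K) : Prop :=
  [/\ forall (a : R[i]) x y, J (a *: x + y) = a^* *: J x + J y,
      forall x y, dot (J x) (J y) = dot y x
    & forall y, exists x, J x = y].

(* Adjoint of a conjugate-linear operator: <J x, y> = <J^* y, x>. *)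
Definition antiadj H K (J : H -> K) : K -> H :=
  get [set S : K -> H | forall x y, dot (J x) y = dot (S y) x].

Definition op_pos H (T : H -> H) : Prop := forall x, 0 <= dot x (T x).

Definition op_le H (S T : H -> H) : Prop := op_pos (T - S).

(* Positivity of a matrix of operators, as an operator on the n-fold direct sum
   of H. *)
Definition opmx_pos H n (A : 'M[H -> H]_n) : Prop :=
  forall h : 'I_n -> H, 0 <= \sum_i \sum_j dot (h i) (A i j (h j)).

Definition commutant H (M : set (H -> H)) : set (H -> H) :=
  [set T | bounded_operator T /\ forall A, M A -> T \o A = A \o T].

Definition von_neumann_algebra H (M : set (H -> H)) : Prop :=
  (forall A, M A -> M (adj A)) /\ commutant (commutant M) = M.

Definition vna_generated H (S : set (H -> H)) : set (H -> H) :=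
  smallest (@von_neumann_algebra H) S.

Definition cyclic H (M : set (H -> H)) (Om : H) : Prop :=
  dense [set A Om | A in M].

Definition separating H (M : set (H -> H)) (Om : H) : Prop :=
  forall A, M A -> A Om = 0 -> A = 0.

Definition standard_form H (M : set (H -> H)) (Om : H) : Prop :=
  [/\ von_neumann_algebra M, cyclic M Om, separating M Om & `|Om| = 1].

Definition vector_state H (Om : H) (A : H -> H) : R[i] := dot Om (A Om).

End Operators.

Section Tomita.
Variable R : realType.
Implicit Types H : hilbertType R.

(* Unbounded operators are represented by their graphs. *)
Definition graph_adj H (G : set (H * H)) : set (H * H) :=
  [set p | forall q, G q -> dot p.2 q.1 = dot p.1 q.2].

(* D is the graph of a densely defined positive self-adjoint operator; it is
   single-valued and linear because it equals its own adjoint. *)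
Definition positive_selfadjoint H (D : set (H * H)) : Prop :=
  [/\ dense [set p.1 | p in D], graph_adj D = D
    & forall p, D p -> 0 <= dot p.1 p.2].

(* Graph of the Tomita operator S, the closure of A Om |-> A^* Om. *)
Definition tomita_operator H (M : set (H -> H)) (Om : H) : set (H * H) :=
  closure [set (A Om, adj A Om) | A in M].

(* J is the anti-unitary part of the polar decomposition S = J D, where
   D = Delta^(1/2).  Such a decomposition is unique. *)
Definition modular_conjugation H (M : set (H -> H)) (Om : H) (J : H -> H) :
    Prop :=
  antiunitary J /\
  exists D : set (H * H), positive_selfadjoint D /\
    tomita_operator M Om = [set (p.1, J p.2) | p in D].

End Tomita.

Section MarkovMaps.
Variable R : realType.
Implicit Types H K : hilbertType R.

(* Maps and states on a von Neumann algebra M on H are functions on all of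
   H -> H; only their values on M matter. *)

Definition linear_on H (V : lmodType R[i]) (M : set (H -> H))
    (f : (H -> H) -> V) : Prop :=
  forall (a : R[i]) A B, M A -> M B -> f (a *: A + B) = a *: f A + f B.

(* The image of a bounded increasing net of self-adjoint elements of M. *)
Definition increasing_family H (M D : set (H -> H)) : Prop :=
  [/\ D !=set0,
      D `<=` M,
      forall A, D A -> adj A = A
    & forall A B, D A -> D B -> exists C, [/\ D C, op_le A C & op_le B C]].

Definition op_supremum H (M D : set (H -> H)) (S : H -> H) : Prop :=
  [/\ M S, forall A, D A -> op_le A S
    & forall T, M T -> (forall A, D A -> op_le A T) -> op_le S T].

Definition normal_faithful_state H (M : set (H -> H))
    (phi : (H -> H) -> R[i]) : Prop :=
  [/\ linear_on (V := R[i]^o) M phi,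
      forall A, M A -> op_pos A -> 0 <= phi A,
      phi id = 1,
      forall D S, increasing_family M D -> op_supremum M D S ->
        supremums (phi @` D) (phi S)
    & forall A, M A -> op_pos A -> phi A = 0 -> A = 0].

Definition probability_space H (M : set (H -> H)) (phi : (H -> H) -> R[i]) :
    Prop :=
  von_neumann_algebra M /\ normal_faithful_state M phi.

Definition completely_positive H K (M : set (H -> H))
    (Phi : (H -> H) -> (K -> K)) : Prop :=
  forall n (A : 'M[H -> H]_n), (forall i j, M (A i j)) ->
    opmx_pos A -> opmx_pos (map_mx Phi A).

Definition normal_map H K (M : set (H -> H)) (N : set (K -> K))
    (Phi : (H -> H) -> (K -> K)) : Prop :=
  forall D S, increasing_family M D -> op_supremum M D S ->
    op_supremum N (Phi @` D) (Phi S).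

Definition stochastic H K (M : set (H -> H)) (phi : (H -> H) -> R[i])
    (N : set (K -> K)) (psi : (K -> K) -> R[i])
    (Phi : (H -> H) -> (K -> K)) : Prop :=
  [/\ forall A, M A -> N (Phi A),
      linear_on M Phi /\ Phi id = id,
      completely_positive M Phi,
      normal_map M N Phi
    & forall A, M A -> psi (Phi A) = phi A].

Definition markov_adjoint H K (M : set (H -> H)) (phi : (H -> H) -> R[i])
    (N : set (K -> K)) (psi : (K -> K) -> R[i])
    (Phi : (H -> H) -> (K -> K)) (Phis : (K -> K) -> (H -> H)) : Prop :=
  stochastic N psi M phi Phis /\
  forall A B, M A -> N B -> psi (B \o Phi A) = phi (Phis B \o A).

Definition preserving_markov H K (M : set (H -> H)) (phi : (H -> H) -> R[i])
    (N : set (K -> K)) (psi : (K -> K) -> R[i])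
    (Phi : (H -> H) -> (K -> K)) : Prop :=
  stochastic M phi N psi Phi /\
  exists Phis, markov_adjoint M phi N psi Phi Phis.

(* Meant for stochastic Phi, which is already linear, unital and normal. *)
Definition deterministic H K (M : set (H -> H))
    (Phi : (H -> H) -> (K -> K)) : Prop :=
  (forall A B, M A -> M B -> Phi (A \o B) = Phi A \o Phi B) /\
  (forall A, M A -> Phi (adj A) = adj (Phi A)).

Definition factorizable H1 H2
    (M1 : set (H1 -> H1)) (phi1 : (H1 -> H1) -> R[i])
    (M2 : set (H2 -> H2)) (phi2 : (H2 -> H2) -> R[i])
    (Phi : (H1 -> H1) -> (H2 -> H2)) : Prop :=
  exists (K : hilbertType R) (N : set (K -> K)) (omega : (K -> K) -> R[i])
    (alpha : (H2 -> H2) -> (K -> K)) (beta : (H1 -> H1) -> (K -> K))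
    (alphas : (K -> K) -> (H2 -> H2)),
  [/\ probability_space N omega,
      preserving_markov M2 phi2 N omega alpha /\ deterministic M2 alpha,
      preserving_markov M1 phi1 N omega beta /\ deterministic M1 beta,
      markov_adjoint M2 phi2 N omega alpha alphas
    & forall A, M1 A -> Phi A = alphas (beta A)].

End MarkovMaps.

(* Stinespring data of Psi : M2 -> M1.  The separation and completion of the
   algebraic tensor product of M2 and H1 is given, up to a unique unitary, by a
   Hilbert space L together with the image st_tens A h in L of each elementary
   tensor: st_tens is bilinear, has the prescribed Gram kernel, and finite sums
   of its values are dense.  The bounded operators sigma(A), tau(Y) and Lambda
   are then the only ones with the given values. *)
Record stinespring (R : realType) (H1 H2 : hilbertType R)
    (M1 : set (H1 -> H1)) (Om1 : H1) (M2 : set (H2 -> H2)) (Om2 : H2)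
    (Psi : (H2 -> H2) -> (H1 -> H1)) (L : hilbertType R) := Stinespring {
  st_tens : (H2 -> H2) -> H1 -> L ;
  st_tens_linearl : forall h, linear_on M2 (fun A => st_tens A h) ;
  st_tens_linearr : forall A, M2 A -> linear (st_tens A) ;
  st_tens_dot : forall A X h k, M2 A -> M2 X ->
    dot (st_tens A h) (st_tens X k) = dot h (Psi (adj A \o X) k) ;
  st_tens_dense : dense [set v | exists n (A : 'I_n -> H2 -> H2) (h : 'I_n -> H1),
    (forall i, M2 (A i)) /\ v = \sum_i st_tens (A i) (h i)] ;

  st_sigma : (H2 -> H2) -> (L -> L) ;
  st_sigma_bounded : forall A, M2 A -> bounded_operator (st_sigma A) ;
  st_sigmaE : forall A X h, M2 A -> M2 X ->
    st_sigma A (st_tens X h) = st_tens (A \o X) h ;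

  st_tau : (H1 -> H1) -> (L -> L) ;
  st_tau_bounded : forall Y, commutant M1 Y -> bounded_operator (st_tau Y) ;
  st_tauE : forall Y X h, commutant M1 Y -> M2 X ->
    st_tau Y (st_tens X h) = st_tens X (Y h) ;

  st_Lambda : H2 -> L ;
  st_Lambda_bounded : bounded_operator st_Lambda ;
  st_LambdaE : forall A, M2 A -> st_Lambda (A Om2) = st_tens A Om1
}.

Definition st_V (R : realType) (H1 H2 : hilbertType R)
    (M1 : set (H1 -> H1)) (Om1 : H1) (M2 : set (H2 -> H2)) (Om2 : H2)
    (Psi : (H2 -> H2) -> (H1 -> H1)) (L : hilbertType R)
    (S : stinespring M1 Om1 M2 Om2 Psi L) (h : H1) : L :=
  st_tens S id h.

Definition st_Omega (R : realType) (H1 H2 : hilbertType R)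
    (M1 : set (H1 -> H1)) (Om1 : H1) (M2 : set (H2 -> H2)) (Om2 : H2)
    (Psi : (H2 -> H2) -> (H1 -> H1)) (L : hilbertType R)
    (S : stinespring M1 Om1 M2 Om2 Psi L) : L :=
  st_tens S id Om1.

Definition st_algebra (R : realType) (H1 H2 : hilbertType R)
    (M1 : set (H1 -> H1)) (Om1 : H1) (M2 : set (H2 -> H2)) (Om2 : H2)
    (Psi : (H2 -> H2) -> (H1 -> H1)) (L : hilbertType R)
    (S : stinespring M1 Om1 M2 Om2 Psi L) (Jh : L -> L) : set (L -> L) :=
  vna_generated
    ([set st_sigma S A | A in M2] `|`
     [set antiadj Jh \o st_tau S Y \o Jh | Y in commutant M1]).

(* Main.v *)
Require Import Defs.
From HB Require Import structures.
From mathcomp Require Import all_boot all_order all_algebra complex.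
From mathcomp Require Import boolp classical_sets functions reals.
From mathcomp Require Import interval_inference topology normedtype.
From mathcomp Require Import ring lra.
Import Order.TTheory GRing.Theory Num.Theory.
Import numFieldNormedType.Exports.
Local Open Scope classical_set_scope.
Local Open Scope ring_scope.

Set Implicit Arguments.
Unset Strict Implicit.
Unset Printing Implicit Defensive.

(** Write [RR] for the algebra generated by [sigma(M2)] and the conjugates
    [Jh^-1 tau(Y) Jh], [Om] for its vector, and [V : H1 -> L], [Lam : H2 -> L]
    for the two isometries, so that compressing [RR] by [V] or [Lam] lands in
    [M1] or [M2].

    _The vector is separating._ If [T] in [RR] kills [Om], the compression of
    [adj T \o T] by [V] is an element of [M1] that kills [Om1], hence is zero, so
    [T V = 0]; in the same way [T Lam = 0].  As [sigma(X) Om = Lam (X Om2)], the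
    operator [T sigma(X)] kills [Om] too, so [T sigma(X) V = 0] for all [X] in
    [M2], and the vectors [sigma(X) V h] are total ([annihilates_range],
    [separating_Om]).

    _The two legs._ The factorization is [Phi = alpha^# beta] with
    [alpha = sigma] and [beta(A) = Jh^-1 tau(J1 A J1) Jh].  Since
    [sigma(A) Om = Lam (A Om2)] and [beta(A) Om = V (A Om1)], the adjoints of
    [alpha] and [beta] are the compressions by [Lam] and [V] (section
    [Dilation]), and [Phi] is recovered by comparing matrix elements
    ([factorization]).  The vectors [sigma(X) beta(A) Om], which are the
    elementary tensors of [X] and [A Om1], give cyclicity.

    _Tomita's commutation theorem for [M1]._ For [beta] to make sense, [J1 A J1]
    has to lie in the commutant of [M1].  The compression by [V] of [Jh^-1 tau(Y) Jh] is
    [J1 Y J1], so the hypothesis on [V] says that [J1] maps the commutant of [M1]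
    into [M1].  The other inclusion follows ([conj_in_commutant]): by the theorem
    of Rieffel and van Daele ([real_density]), the vectors [A Om1 + i Y Om1], with
    [A] and [Y] self-adjoint in [M1] and its commutant, are dense; together with
    the reality of [<A Om1, J1 B Om1>] this makes every [A Om1] a limit of vectors
    [x Om1] with [x] self-adjoint in [J1 M1' J1], which is enough to see that [A]
    commutes with [J1 M1 J1].  The facts on [J1] that this uses, [J1 J1 = 1] and
    [J1 Om1 = Om1], are read off the polar decomposition of the Tomita operator
    ([modular_conjugation_antiadj], [conjugation_Om]).

    _Normality and complete positivity._ A positive map that carries one vector
    state to another whose vector is separating is normal, because the defect
    between the image of a supremum and the supremum of the images is a positive
    operator that kills the vector ([normal_of_state]).  The homomorphisms
    [alpha] and [beta] are completely positive because a symmetric contraction in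
    the domain has bounded powers, hence so has its image, which is therefore a
    contraction too ([hom_completely_positive]). *)

(** * Real and complex numbers *)

Section Scalars.
Variable R : realType.

Lemma sqr_le0_eq0 (x : R) : x ^+ 2 <= 0 -> x = 0.
Proof.
move=> h; have : x ^+ 2 == 0 by rewrite eq_le h sqr_ge0.
by rewrite expf_eq0 => /eqP.
Qed.

Lemma le_of_eps (a b k : R) : 0 <= k ->
  (forall e : R, 0 < e -> a <= b + e * k) -> a <= b.
Proof.
move=> k0 h; apply/ler_addgt0Pr => e e0.
have k1 : 0 < k + 1 by rewrite ltr_wpDl.
have := h (e / (k + 1)) (divr_gt0 e0 k1).
move=> /le_trans; apply; rewrite lerD2l -mulrA ler_piMr ?(ltW e0)//.
by rewrite mulrC ler_pdivrMr// mul1r lerDl.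
Qed.

Lemma quadratic_eq0 (c N : R) : 0 <= N ->
  (forall t : R, 2 * t * c <= t ^+ 2 * N) -> c = 0.
Proof.
move=> N0 h; have N1 : 0 < N + 1 by rewrite ltr_wpDl.
have := h (c / (N + 1)).
rewrite -(ler_pM2r (exprn_gt0 2 N1)).
have -> : 2 * (c / (N + 1)) * c * (N + 1) ^+ 2 = 2 * c ^+ 2 * (N + 1).
  by field; rewrite gt_eqF.
have -> : (c / (N + 1)) ^+ 2 * N * (N + 1) ^+ 2 = c ^+ 2 * N.
  by field; rewrite gt_eqF.
move=> h2; have : c ^+ 2 * (N + 2) <= 0 by lra.
by rewrite pmulr_lle0 ?ltr_wpDl//; apply: sqr_le0_eq0.
Qed.

Lemma inv_small (e : R) : 0 < e ->
  exists N, forall n, (N <= n)%N -> n.+1%:R^-1 < e.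
Proof.
move=> e0; have [N _ hN] := near_infty_natSinv_lt (PosNum e0).
by exists N => n Nn; apply: hN.
Qed.

Lemma sqr_lt (a b : R) : 0 <= a -> 0 < b -> a ^+ 2 < b ^+ 2 ->
  a < b.
Proof. by move=> a0 b0; rewrite ltr_pXn2r ?nnegrE// ltW. Qed.

(** A convex sequence that ever increases keeps increasing at least linearly.
    This replaces spectral arguments twice below, for the sequences
    [<u, J^(2n) v>] and [<v, T^(2n) v>]. *)
Lemma convex_bounded_le (c : nat -> R) (C : R) :
  (forall n, 0 <= c n - 2 * c n.+1 + c n.+2) -> (forall n, c n <= C) ->
  c 1%N <= c 0%N.
Proof.
move=> cvx bnd; rewrite leNgt; apply/negP => lt01.
have incr n : c 1%N - c 0%N <= c n.+1 - c n.
  elim: n => [|n IHn] //; have := cvx n; lra.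
have grow n : c 0%N + n%:R * (c 1%N - c 0%N) <= c n.
  elim: n => [|n IHn]; first by rewrite mul0r addr0.
  by have := incr n; rewrite -natr1 mulrDl mul1r; lra.
have d0 : 0 < c 1%N - c 0%N by rewrite subr_gt0.
set q := (C - c 0%N) / (c 1%N - c 0%N).
have := grow (Num.bound `|q|).
rewrite leNgt => /negP; apply; apply: le_lt_trans (bnd _) _.
rewrite -ltrBlDl -ltr_pdivrMr// -/q.
exact: le_lt_trans (ler_norm _) (archi_boundP (normr_ge0 q)).
Qed.

Lemma Re_norm_ge0 (a : R[i]) : 0 <= complex.Re `|a|.
Proof. by have := normr_ge0 a; rewrite lecE => /andP[]. Qed.

Lemma Re_norm_le0 (z : R[i]) : complex.Re `|z| <= 0 -> z = 0.
Proof.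
move=> h; apply/eqP; rewrite -normr_eq0 eq_le normr_ge0 andbT.
by rewrite -[`|z|]RRe_real ?normr_real// -(rmorph0 (real_complex R)) lecR.
Qed.

Lemma conj_eq_Im0 (z : R[i]) : z = z^* -> complex.Im z = 0.
Proof.
by case: z => a b [] /eqP; rewrite -addr_eq0 -mulr2n mulrn_eq0 => /eqP.
Qed.

Lemma pos0P (z : R[i]) : 0 <= z <-> complex.Im z = 0 /\ 0 <= complex.Re z.
Proof. by rewrite lecE /=; split=> [/andP[/eqP]|[-> ->]]; rewrite ?eqxx. Qed.

(** Polarization: only the values of the form on [x + y] and [x + i y] are used. *)
Lemma hermitian_of_real (V : lmodType R[i]) (F : V -> V -> R[i]) :
  (forall x y z, F (x + y) z = F x z + F y z) ->
  (forall x y z, F x (y + z) = F x y + F x z) ->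
  (forall x y, F ('i *: x) y = - 'i * F x y) ->
  (forall x y, F x ('i *: y) = 'i * F x y) ->
  (forall x, complex.Im (F x x) = 0) -> forall x y, F y x = (F x y)^*.
Proof.
move=> FDl FDr FZl FZr h x y.
move: (h x) (h y) (h (x + y)) (h (x + 'i *: y)).
rewrite !(FDl, FDr, FZl, FZr) !raddfD.
have -> : 'i = 'i%C :> R[i] by [].
case: (F x x) => e f; case: (F x y) => c d; case: (F y x) => a b.
case: (F y y) => p q /= h1 h2 h3 h4.
by apply/eqP; rewrite eq_complex; apply/andP; split; apply/eqP => /=; lra.
Qed.

End Scalars.

(** * Inner products and norms *)

Section InnerProduct.
Variables (R : realType) (H : hilbertType R).
Implicit Types (x y z : H) (a : R[i]).

(** The underlying real Hilbert space: the projection theorem and the density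
    theorem of Rieffel and van Daele concern real subspaces. *)
Definition rdot x y : R := complex.Re (dot x y).

Definition nrm x : R := complex.Re `|x|.

Lemma dotDr x y z : dot x (y + z) = dot x y + dot x z.
Proof. by rewrite -[y in LHS]scale1r dotDZr mul1r. Qed.

Lemma dot0r x : dot x 0 = 0.
Proof. by apply: (addrI (dot x 0)); rewrite -dotDr !addr0. Qed.

Lemma dotZr a x y : dot x (a *: y) = a * dot x y.
Proof. by rewrite -[a *: y]addr0 dotDZr dot0r addr0. Qed.

Lemma dotNr x y : dot x (- y) = - dot x y.
Proof. by rewrite -scaleN1r dotZr mulN1r. Qed.

Lemma dotBr x y z : dot x (y - z) = dot x y - dot x z.
Proof. by rewrite dotDr dotNr. Qed.

Lemma dotDl x y z : dot (y + z) x = dot y x + dot z x.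
Proof. by rewrite (dotC x (y + z)) dotDr (dotC x y) (dotC x z) -rmorphD. Qed.

Lemma dot0l x : dot 0 x = 0.
Proof. by rewrite dotC dot0r rmorph0. Qed.

Lemma dotZl a x y : dot (a *: y) x = a^* * dot y x.
Proof. by rewrite (dotC x (a *: y)) dotZr (dotC x y) -rmorphM. Qed.

Lemma dotNl x y : dot (- y) x = - dot y x.
Proof. by rewrite (dotC x (- y)) dotNr (dotC x y) -rmorphN. Qed.

Lemma dotBl x y z : dot (y - z) x = dot y x - dot z x.
Proof. by rewrite dotDl dotNl. Qed.

Lemma dot_sumr (I : finType) x (f : I -> H) :
  dot x (\sum_i f i) = \sum_i dot x (f i).
Proof. by apply: (big_morph (dot x)) => [y z|]; rewrite ?dotDr ?dot0r. Qed.

Lemma dot_suml (I : finType) x (f : I -> H) :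
  dot (\sum_i f i) x = \sum_i dot (f i) x.
Proof. by apply: (big_morph (dot^~ x)) => [y z|]; rewrite ?dotDl ?dot0l. Qed.

Lemma nrmE x : (nrm x)%:C%C = `|x|.
Proof. by rewrite /nrm RRe_real// normr_real. Qed.

Lemma dot_nrm x : dot x x = (nrm x ^+ 2)%:C%C.
Proof. by rewrite dotxx -nrmE rmorphXn. Qed.

Lemma nrm_ge0 x : 0 <= nrm x.
Proof. by rewrite -lecR nrmE normr_ge0. Qed.

Lemma nrm0_eq0 x : nrm x = 0 -> x = 0.
Proof. by move=> h; apply/eqP; rewrite -normr_eq0 -nrmE h. Qed.

Lemma nrm0 : nrm 0 = 0.
Proof. by rewrite /nrm normr0. Qed.

Lemma nrmN x : nrm (- x) = nrm x.
Proof. by rewrite /nrm normrN. Qed.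

Lemma nrmD x y : nrm (x + y) <= nrm x + nrm y.
Proof. by rewrite -lecR rmorphD /= !nrmE ler_normD. Qed.

Lemma nrmB x y : nrm (x - y) = nrm (y - x).
Proof. by rewrite -nrmN opprB. Qed.

Lemma nrmZ a x : nrm (a *: x) = complex.Re `|a| * nrm x.
Proof.
apply: complexI; rewrite nrmE normrZ.
have -> : `|a| = (complex.Re `|a|)%:C%C by rewrite RRe_real ?normr_real.
by rewrite -nrmE -rmorphM.
Qed.

Lemma nrmZr (r : R) x : nrm (r%:C%C *: x) = `|r| * nrm x.
Proof. by rewrite nrmZ normc_def /= expr0n /= addr0 sqrtr_sqr. Qed.

Lemma rdotC x y : rdot x y = rdot y x.
Proof. by rewrite /rdot dotC; case: (dot y x). Qed.

Lemma rdotDr x y z : rdot x (y + z) = rdot x y + rdot x z.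
Proof. by rewrite /rdot dotDr raddfD. Qed.

Lemma rdotDl x y z : rdot (y + z) x = rdot y x + rdot z x.
Proof. by rewrite !(rdotC _ x) rdotDr. Qed.

Lemma rdotNr x y : rdot x (- y) = - rdot x y.
Proof. by rewrite /rdot dotNr raddfN. Qed.

Lemma rdotNl x y : rdot (- y) x = - rdot y x.
Proof. by rewrite /rdot dotNl raddfN. Qed.

Lemma rdotZr (r : R) x y : rdot x (r%:C%C *: y) = r * rdot x y.
Proof. by rewrite /rdot dotZr; case: (dot x y) => a b /=; rewrite mul0r subr0. Qed.

Lemma rdotZl (r : R) x y : rdot (r%:C%C *: y) x = r * rdot y x.
Proof. by rewrite !(rdotC _ x) rdotZr. Qed.

Lemma rdot0r x : rdot x 0 = 0. Proof. by rewrite /rdot dot0r. Qed.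
Lemma rdot0l x : rdot 0 x = 0. Proof. by rewrite /rdot dot0l. Qed.

Lemma rdotxx x : rdot x x = nrm x ^+ 2.
Proof. by rewrite /rdot dot_nrm. Qed.

Definition rdotE := (rdotDr, rdotDl, rdotNr, rdotNl, rdotZr, rdotZl).

Lemma Im_dot x y : complex.Im (dot x y) = - rdot x ('i *: y).
Proof.
rewrite /rdot dotZr; case: (dot x y) => a b.
by have -> : 'i = 'i%C :> R[i] by []; rewrite /= mul0r mul1r sub0r opprK.
Qed.

Lemma nrm_sqD x y : nrm (x + y) ^+ 2 = nrm x ^+ 2 + 2 * rdot x y + nrm y ^+ 2.
Proof. by rewrite -!rdotxx !rdotE (rdotC y x); ring. Qed.

Lemma nrm_sqB x y : nrm (x - y) ^+ 2 = nrm x ^+ 2 - 2 * rdot x y + nrm y ^+ 2.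
Proof. by rewrite nrm_sqD nrmN rdotNr; ring. Qed.

Lemma rdot_le x y : rdot x y <= nrm x * nrm y.
Proof.
have [] := eqVneq (nrm x) 0 => [/nrm0_eq0 ->|x0]; first by rewrite rdot0l nrm0 mul0r.
have [] := eqVneq (nrm y) 0 => [/nrm0_eq0 ->|y0]; first by rewrite rdot0r nrm0 mulr0.
have hx : 0 < nrm x by rewrite lt0r x0 nrm_ge0.
have hy : 0 < nrm y by rewrite lt0r y0 nrm_ge0.
have := sqr_ge0 (nrm ((nrm y)%:C%C *: x - (nrm x)%:C%C *: y)).
rewrite nrm_sqB !nrmZr !rdotE !ger0_norm ?nrm_ge0// => h.
have : 0 <= (2 * nrm x * nrm y) * (nrm x * nrm y - rdot x y) by lra.
by rewrite pmulr_rge0 ?subr_ge0// !mulr_gt0.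
Qed.

Lemma rdot_abs x y : `|rdot x y| <= nrm x * nrm y.
Proof.
by rewrite ler_norml rdot_le andbT lerNl -rdotNl -(nrmN x) rdot_le.
Qed.

Lemma dot_rdot x y : dot x y = (rdot x y)%:C%C - 'i * (rdot x ('i *: y))%:C%C.
Proof.
rewrite [LHS]complexE -[complex.Re _]/(rdot x y) Im_dot.
have -> : 'i = 'i%C :> R[i] by [].
by rewrite rmorphN mulrN.
Qed.

Lemma dot_eq0P x y : (dot x y = 0) <-> (rdot x y = 0 /\ rdot x ('i *: y) = 0).
Proof.
split=> [h|[h1 h2]]; first by rewrite /rdot dotZr h mulr0.
by rewrite dot_rdot h1 h2 mulr0 subr0.
Qed.

Lemma rdot_ext x : (forall y, rdot y x = 0) -> x = 0.
Proof.
move=> h; apply: nrm0_eq0; have := h x; rewrite rdotxx => /eqP.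
by rewrite expf_eq0 /= => /eqP.
Qed.

Lemma dot_ext x y : (forall z, dot z x = dot z y) -> x = y.
Proof.
move=> h; apply/eqP; rewrite -subr_eq0; apply/eqP/rdot_ext => z.
by rewrite /rdot dotBr h subrr.
Qed.

Lemma dot_self_ge0 x : 0 <= dot x x.
Proof. by rewrite dot_nrm ler0c sqr_ge0. Qed.

Lemma dot_self_eq0 x : dot x x = 0 -> x = 0.
Proof. by rewrite dot_nrm => /complexI/eqP; rewrite expf_eq0 => /eqP/nrm0_eq0. Qed.

Lemma scale_i_nrm x : nrm ('i *: x) = nrm x.
Proof. by rewrite nrmZ normCi /= mul1r. Qed.

Lemma dot_le x y : `|dot x y| <= (2 * (nrm x * nrm y))%:C%C.
Proof.
rewrite dot_rdot (le_trans (ler_normB _ _))// normrM.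
have -> : `|'i : R[i]| = 1 by rewrite normCi.
have nC (r : R) : `|r%:C%C| = `|r|%:C%C :> R[i].
  by rewrite normc_def /= expr0n /= addr0 sqrtr_sqr.
rewrite mul1r !nC -rmorphD lecR mulr_natl mulr2n lerD ?rdot_abs//.
apply: le_trans (rdot_abs _ _) _; rewrite nrmZ normCi /= mul1r //.
Qed.

Definition norm_dense (S : set H) :=
  forall x (e : R), 0 < e -> exists2 s, S s & nrm (x - s) < e.

Lemma denseP (S : set H) : dense S <-> norm_dense S.
Proof.
split=> [dS x e e0|h O [x Ox] oO].
  have [|y [By Sy]] := dS (ball x e%:C%C) _ (ball_open _ _).
    by exists x; apply: ballxx; rewrite ltcR.
  by exists y => //; move: By; rewrite -ball_normE /= -nrmE ltcR.
have /nbhs_ballP [e /= e0 he] := open_nbhs_nbhs (conj oO Ox).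
have ee : e = (complex.Re e)%:C%C by rewrite RRe_real// gtr0_real.
have [y Sy] := h x (complex.Re e) ltac:(by rewrite -ltcR -ee).
rewrite -ltcR nrmE -ee => hy; exists y; split=> //.
by apply: he; rewrite -ball_normE.
Qed.

Lemma complete_seq (u : nat -> H) :
  (forall e : R, 0 < e -> exists N, forall m n, (N <= m)%N -> (N <= n)%N ->
     nrm (u m - u n) < e) ->
  exists l, forall e : R, 0 < e -> exists N, forall n, (N <= n)%N ->
     nrm (u n - l) < e.
Proof.
move=> hu.
have /cvg_ex [l hl] : cvg (u @ \oo).
  apply: cauchy_cvg; apply: cauchy_exP => e e0.
  have ee : e = (complex.Re e)%:C%C by rewrite RRe_real// gtr0_real.
  have [N hN] := hu (complex.Re e) ltac:(by rewrite -ltcR -ee).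
  exists (u N), N => // n /= Nn; rewrite -ball_normE /= -nrmE ee ltcR.
  exact: hN.
exists l => e e0.
have [N _ hN] := cvg_ball hl (ltac:(by rewrite ltcR) : 0 < e%:C%C).
exists N => n Nn; have := hN n Nn.
by rewrite -ball_normE /= -nrmE ltcR nrmB.
Qed.

End InnerProduct.

Lemma closure_pairP (R : realType) (H K : hilbertType R) (G : set (H * K)) p :
  closure G p <-> (forall e : R, 0 < e ->
     exists2 q, G q & nrm (p.1 - q.1) < e /\ nrm (p.2 - q.2) < e).
Proof.
split=> [cG e e0|h].
  have /cG [q [Gq [/= h1 h2]]] : nbhs p (ball p e%:C%C).
    by apply: nbhsx_ballx; rewrite ltcR.
  exists q => //; move: h1 h2; rewrite -!ball_normE /= -!nrmE !ltcR; by split.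
move=> B /nbhs_ballP [e /= e0 he].
have ee : e = (complex.Re e)%:C%C by rewrite RRe_real// gtr0_real.
have [q Gq [h1 h2]] := h (complex.Re e) ltac:(by rewrite -ltcR -ee).
exists q; split=> //; apply: he.
by split; rewrite -ball_normE /= -nrmE ee ltcR.
Qed.

(** * Orthogonal projection *)

Section Projection.
Variables (R : realType) (H K : hilbertType R).
Implicit Types (G : set (H * K)) (p q x : H * K).

Definition real_subspace G := G (0, 0) /\
  forall (r : R) p q, G p -> G q ->
    G (r%:C%C *: p.1 + q.1, r%:C%C *: p.2 + q.2).

Definition pdot p q : R := rdot p.1 q.1 + rdot p.2 q.2.

Definition psub p q : H * K := (p.1 - q.1, p.2 - q.2).

Lemma pdot_ge0 p : 0 <= pdot p p.
Proof. by rewrite /pdot !rdotxx addr_ge0// sqr_ge0. Qed.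

(** The projection theorem.  It is stated for pairs, with the Hilbert sum norm
    hidden in [pdot], since the product of two Hilbert spaces carries the
    maximum norm; a single space is recovered by taking second components zero.
    A minimizing sequence is Cauchy by the parallelogram law, and [p] is its
    limit; orthogonality comes from the first variation, whose error tends to
    zero along the sequence. *)
Lemma near_subspace G x : real_subspace G -> exists2 p, closure G p &
  forall g, G g -> pdot (psub x p) g = 0.
Proof.
move=> [G0 GD].
pose E : set R := [set pdot (psub x g) (psub x g) | g in G].
have E0 : has_inf E.
  split; first by exists (pdot (psub x (0, 0)) (psub x (0, 0))), (0, 0).
  by exists 0 => _ [g _ <-]; apply: pdot_ge0.
pose d := inf E.
have dE g : G g -> d <= pdot (psub x g) (psub x g).
  by move=> Gg; apply: ge_inf; [case: E0 | exists g].
have /choice [u hu] : forall n : nat, exists g, G g /\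
    pdot (psub x g) (psub x g) < d + n.+1%:R^-1.
  move=> n; have n0 : 0 < n.+1%:R^-1 :> R by rewrite invr_gt0 ltr0n.
  by have [_ [g Gg <-] hg] := inf_adherent n0 E0; exists g.
have Gu n : G (u n) by case: (hu n).
have var n g (t : R) : G g ->
    2 * t * pdot (psub x (u n)) g <= n.+1%:R^-1 + t ^+ 2 * pdot g g.
  move=> Gg; have := dE _ (GD t _ _ Gg (Gu n)).
  have [_] := hu n; rewrite /pdot /psub /= !rdotE.
  rewrite !(rdotC _ x.1) !(rdotC _ x.2) !(rdotC g.1 (u n).1) !(rdotC g.2 (u n).2).
  by move: (d) (n.+1%:R^-1) => d1 i h1 h2; nra.
have caux m n : pdot (psub (u m) (u n)) (psub (u m) (u n)) <=
    2 * m.+1%:R^-1 + 2 * n.+1%:R^-1.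
  have G2 : G ((2^-1)%:C%C *: (u n).1, (2^-1)%:C%C *: (u n).2).
    by have := GD 2^-1 _ _ (Gu n) G0; rewrite /= !addr0.
  have := dE _ (GD 2^-1 _ _ (Gu m) G2).
  have [_] := hu n; have [_] := hu m; rewrite /pdot /psub /= !rdotE.
  rewrite !(rdotC _ x.1) !(rdotC _ x.2) !(rdotC (u m).1 (u n).1).
  rewrite !(rdotC (u m).2 (u n).2).
  by move: (d) (m.+1%:R^-1) (n.+1%:R^-1) => d1 i j h1 h2 h3; lra.
have cau (e : R) : 0 < e -> exists N, forall m n, (N <= m)%N -> (N <= n)%N ->
    pdot (psub (u m) (u n)) (psub (u m) (u n)) < e ^+ 2.
  move=> e0; have [|N hN] := @inv_small R (e ^+ 2 / 4).
    by rewrite divr_gt0 ?exprn_gt0.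
  exists N => m n Nm Nn; apply: le_lt_trans (caux m n) _.
  by move: (hN _ Nm) (hN _ Nn); move: (m.+1%:R^-1) (n.+1%:R^-1) => i j; lra.
have [l1 hl1] : exists l, forall e : R, 0 < e -> exists N, forall n, (N <= n)%N ->
     nrm ((u n).1 - l) < e.
  apply: (complete_seq (u := fun n => (u n).1)) => e e0.
  have [N hN] := cau _ e0; exists N => m n Nm Nn.
  apply: sqr_lt => //; first exact: nrm_ge0.
  apply: le_lt_trans (hN _ _ Nm Nn).
  by rewrite /pdot !rdotxx lerDl sqr_ge0.
have [l2 hl2] : exists l, forall e : R, 0 < e -> exists N, forall n, (N <= n)%N ->
     nrm ((u n).2 - l) < e.
  apply: (complete_seq (u := fun n => (u n).2)) => e e0.
  have [N hN] := cau _ e0; exists N => m n Nm Nn.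
  apply: sqr_lt => //; first exact: nrm_ge0.
  apply: le_lt_trans (hN _ _ Nm Nn).
  by rewrite /pdot !rdotxx lerDr sqr_ge0.
have lim (e : R) : 0 < e -> exists n,
    [/\ n.+1%:R^-1 < e, nrm ((u n).1 - l1) < e & nrm ((u n).2 - l2) < e].
  move=> e0; have [N0 h0] := inv_small e0.
  have [N1 h1] := hl1 _ e0; have [N2 h2] := hl2 _ e0.
  exists (maxn N0 (maxn N1 N2)); split; [apply: h0|apply: h1|apply: h2];
    by rewrite !leq_max leqnn ?orbT.
exists (l1, l2).
  apply/closure_pairP => e e0; have [n [_ h1 h2]] := lim _ e0.
  by exists (u n) => //=; split; rewrite nrmB.
move=> g Gg; apply: (@quadratic_eq0 _ _ (pdot g g)) (pdot_ge0 g) _ => t.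
apply: (@le_of_eps _ _ _ (1 + 2 * `|t| * (nrm g.1 + nrm g.2))).
  by rewrite addr_ge0// !mulr_ge0// addr_ge0// nrm_ge0.
move=> e e0; have [n [hn h1 h2]] := lim _ e0.
have eq : pdot (psub x (l1, l2)) g =
    pdot (psub x (u n)) g + pdot (psub (u n) (l1, l2)) g.
  by rewrite /pdot /psub /= !rdotE; ring.
have b : `|pdot (psub (u n) (l1, l2)) g| <= e * (nrm g.1 + nrm g.2).
  rewrite /pdot /psub /= (le_trans (ler_normD _ _))// mulrDr lerD//.
    by apply: le_trans (rdot_abs _ _) _; rewrite ler_wpM2r ?nrm_ge0// ltW.
  by apply: le_trans (rdot_abs _ _) _; rewrite ler_wpM2r ?nrm_ge0// ltW.
have := var n g t Gg; rewrite eq.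
have : t * pdot (psub (u n) (l1, l2)) g <= `|t| * (e * (nrm g.1 + nrm g.2)).
  by apply: le_trans (ler_norm _) _; rewrite normrM ler_wpM2l.
by move: (n.+1%:R^-1) hn => i hn h3 h4; lra.
Qed.
End Projection.

Section Subspace.
Variables (R : realType) (H : hilbertType R).
Implicit Types (G : set H).

Definition real_subspace1 G := G 0 /\
  forall (r : R) x y, G x -> G y -> G (r%:C%C *: x + y).

Lemma near_subspace1 G (x : H) : real_subspace1 G -> exists p,
  (forall e : R, 0 < e -> exists2 g, G g & nrm (p - g) < e) /\
  (forall g, G g -> rdot (x - p) g = 0).
Proof.
move=> [G0 GD].
pose G2 : set (H * H) := [set p | G p.1 /\ p.2 = 0].
have [|p cp hp] := @near_subspace _ _ _ G2 (x, 0).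
  split=> // r p q [p1 p2] [q1 q2]; split; first exact: GD.
  by rewrite /= p2 q2 scaler0 addr0.
exists p.1; split=> [e e0|g Gg].
  by have /closure_pairP/(_ e e0) [q [q1 _] [h _]] := cp; exists q.1.
by have := hp (g, 0) (conj Gg erefl); rewrite /pdot /= rdot0r addr0.
Qed.

Lemma dense_of_orthogonal G : real_subspace1 G ->
  (forall x, (forall g, G g -> rdot x g = 0) -> x = 0) ->
  norm_dense G.
Proof.
move=> GS G0 x; have [p [hp op]] := near_subspace1 x GS.
by have /eqP := G0 _ op; rewrite subr_eq0 => /eqP ->.
Qed.
End Subspace.

(** * Bounded operators and adjoints *)

Section Bounded.
Variables (R : realType).
Implicit Types H K : hilbertType R.

Section Linear.
Variables (H K : hilbertType R) (T : H -> K).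
Hypothesis linT : linear T.

Lemma linD x y : T (x + y) = T x + T y.
Proof. by rewrite -[x in LHS]scale1r linT scale1r. Qed.

Lemma lin0 : T 0 = 0.
Proof. by apply: (addrI (T 0)); rewrite -linD !addr0. Qed.

Lemma linZ (a : R[i]) x : T (a *: x) = a *: T x.
Proof. by rewrite -[a *: x]addr0 linT lin0 addr0. Qed.

Lemma linN x : T (- x) = - T x.
Proof. by rewrite -scaleN1r linZ scaleN1r. Qed.

Lemma linB x y : T (x - y) = T x - T y.
Proof. by rewrite linD linN. Qed.

Lemma lin_sum (I : finType) (f : I -> H) : T (\sum_i f i) = \sum_i T (f i).
Proof. by apply: (big_morph T) => [x y|]; rewrite ?linD ?lin0. Qed.

End Linear.

Lemma boundedP H K (T : H -> K) : bounded_operator T ->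
  linear T /\ exists2 c : R, 0 <= c & forall x, nrm (T x) <= c * nrm x.
Proof.
move=> [lT [c hc]]; split=> //; exists `|complex.Re c| => // x.
have := hc x; rewrite -!nrmE lecE => /andP[_ /=].
by case: c {hc} => a b /=; rewrite mulr0 subr0 => /le_trans; apply;
  rewrite ler_wpM2r ?nrm_ge0 ?ler_norm.
Qed.

Lemma boundedI H K (T : H -> K) (c : R) : linear T ->
  (forall x, nrm (T x) <= c * nrm x) -> bounded_operator T.
Proof.
move=> lT hc; split=> //; exists c%:C%C => x.
by rewrite -!nrmE -rmorphM lecR.
Qed.

Lemma bounded_linear H K (T : H -> K) : bounded_operator T -> linear T.
Proof. by case. Qed.

(** The vector spanning the orthogonal complement of the kernel, rescaled. *)
Lemma riesz H (f : H -> R[i]) (c : R) :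
  (forall a x y, f (a *: x + y) = a * f x + f y) ->
  0 <= c -> (forall x, `|f x| <= (c * nrm x)%:C%C) ->
  exists z, forall x, f x = dot z x.
Proof.
move=> lf c0 hc.
have f0 : f 0 = 0.
  apply/eqP; rewrite -normr_eq0 eq_le normr_ge0 andbT.
  by rewrite (le_trans (hc 0))// nrm0 mulr0.
have fZ a x : f (a *: x) = a * f x by rewrite -[a *: x]addr0 lf f0 addr0.
have fB x y : f (x - y) = f x - f y.
  by rewrite addrC -scaleN1r lf mulN1r addrC.
have [[x0 x00]|/forallNP all0] := pselect (exists x, f x <> 0); last first.
  by exists 0 => x; rewrite dot0l; apply: contrapT; apply: all0.
pose x1 := (f x0)^-1 *: x0.
have fx1 : f x1 = 1 by rewrite fZ mulVf//; apply/eqP.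
have [|p [cp op]] := @near_subspace1 _ _ [set x | f x = 0] x1.
  by split=> //= r x y hx hy; rewrite lf hx hy mulr0 addr0.
have fp : f p = 0.
  apply: Re_norm_le0; apply: (@le_of_eps _ _ _ c) => // e e0; rewrite add0r.
  have [g gf hg] := cp e e0.
  have -> : f p = f (p - g) by rewrite fB gf subr0.
  have := hc (p - g); rewrite lecE => /andP[_ /le_trans]; apply.
  by rewrite /= mulrC ler_wpM2r// ltW.
pose w := x1 - p.
have fw : f w = 1 by rewrite fB fx1 fp subr0.
have ww : dot w w != 0.
  apply/eqP => /dot_self_eq0 w0.
  by have := fw; rewrite w0 f0 => /esym/eqP; rewrite oner_eq0.
have ow g : f g = 0 -> dot w g = 0.
  move=> fg; apply/dot_eq0P; split; apply: op => //=.
  by rewrite fZ fg mulr0.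
exists (((dot w w)^-1)^* *: w) => x.
rewrite dotZl conjCK.
have /ow : f (x - f x *: w) = 0 by rewrite fB fZ fw mulr1 subrr.
rewrite dotBr dotZr => /eqP; rewrite subr_eq0 => /eqP ->.
by rewrite mulrCA mulVf ?mulr1.
Qed.

Lemma adj_ex H K (T : H -> K) : bounded_operator T ->
  exists S : K -> H, forall x y, dot (T x) y = dot x (S y).
Proof.
move=> /boundedP [lT [c c0 hc]].
suff /choice [S hS] : forall y, exists z, forall x, dot y (T x) = dot z x.
  by exists S => x y; rewrite dotC hS -dotC.
move=> y; apply: (@riesz _ _ (2 * (nrm y * c))).
- by move=> a x z; rewrite lT dotDr dotZr.
- by rewrite !mulr_ge0 ?nrm_ge0.
- move=> x; apply: le_trans (dot_le _ _) _; rewrite lecR -!mulrA.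
  by rewrite ler_wpM2l// ler_wpM2l ?nrm_ge0.
Qed.

Lemma adjP H K (T : H -> K) : bounded_operator T ->
  forall x y, dot (T x) y = dot x (adj T y).
Proof.
move=> bT.
exact: (@getPex _ [set S : K -> H | forall x y, dot (T x) y = dot x (S y)] (adj_ex bT)).
Qed.

Lemma adjPr H K (T : H -> K) : bounded_operator T ->
  forall x y, dot (adj T x) y = dot x (T y).
Proof. by move=> bT x y; rewrite dotC -adjP// -dotC. Qed.

(** [adj T] is chosen among the solutions of the adjoint equation, of which there
    is at most one. *)
Lemma adj_eq H K (T : H -> K) (S : K -> H) :
  (forall x y, dot (T x) y = dot x (S y)) -> adj T = S.
Proof.
move=> hS.
have hA : forall x y, dot (T x) y = dot x (adj T y).
  by apply: (@getPex _ [set S : K -> H | forall x y, dot (T x) y = dot x (S y)]);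
    exists S.
by apply/funext => y; apply: dot_ext => z; rewrite -hA hS.
Qed.

Lemma linear_adjoint H K (T : H -> K) (S : K -> H) :
  (forall x y, dot (T x) y = dot x (S y)) -> linear S.
Proof.
by move=> hS a x y; apply: dot_ext => z; rewrite -hS !dotDr !dotZr !hS.
Qed.

Lemma nrm_le_of_rdot H (x : H) (c : R) : 0 <= c ->
  (forall y, rdot x y <= c * nrm y) -> nrm x <= c.
Proof.
move=> c0 /(_ x); rewrite rdotxx expr2.
have [-> //|x0] := eqVneq (nrm x) 0.
by rewrite ler_pM2r// lt0r x0 nrm_ge0.
Qed.

Lemma bounded_adj H K (T : H -> K) : bounded_operator T ->
  bounded_operator (adj T).
Proof.
move=> bT; have [lT [c c0 hc]] := boundedP bT.
apply: (@boundedI _ _ _ c) (linear_adjoint (adjP bT)) _ => y.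
apply: nrm_le_of_rdot; first by rewrite mulr_ge0 ?nrm_ge0.
move=> x; rewrite /rdot adjPr// -/(rdot _ _) (le_trans (rdot_le _ _))//.
by rewrite [leRHS]mulrAC mulrC ler_wpM2r ?nrm_ge0.
Qed.

Lemma adjK H K (T : H -> K) : bounded_operator T -> adj (adj T) = T.
Proof. by move=> bT; apply: adj_eq => x y; rewrite adjPr. Qed.

Lemma bounded_id H : bounded_operator (@id H).
Proof. by apply: (@boundedI _ _ _ 1) => [a x y|x]; rewrite ?mul1r. Qed.

Lemma bounded0 H K : bounded_operator (0 : H -> K).
Proof.
apply: (@boundedI _ _ _ 0) => [b x y|x].
  by change (0 = b *: (0 : K) + 0); rewrite scaler0 addr0.
by rewrite mul0r -[X in _ <= X](@nrm0 R K).
Qed.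

Lemma bounded_comp H K (L : hilbertType R) (S : K -> L) (T : H -> K) :
  bounded_operator S -> bounded_operator T -> bounded_operator (S \o T).
Proof.
move=> /boundedP[lS [c c0 hc]] /boundedP[lT [d d0 hd]].
apply: (@boundedI _ _ _ (c * d)) => [a x y|x] /=; first by rewrite lT lS.
by rewrite (le_trans (hc _))// -mulrA ler_wpM2l.
Qed.

Lemma bounded_lin H K (a : R[i]) (S T : H -> K) :
  bounded_operator S -> bounded_operator T -> bounded_operator (a *: S + T).
Proof.
move=> /boundedP[lS [c c0 hc]] /boundedP[lT [d d0 hd]].
apply: (@boundedI _ _ _ (complex.Re `|a| * c + d)) => [b x y|x]; rewrite !fctE.
  by rewrite lS lT !scalerDr !scalerA mulrC !addrA; congr (_ + _); rewrite addrAC.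
rewrite (le_trans (nrmD _ _))// mulrDl lerD// nrmZ -mulrA ler_wpM2l//.
by rewrite -lecR RRe_real ?normr_real// normr_ge0.
Qed.

Lemma boundedZ H K (a : R[i]) (T : H -> K) :
  bounded_operator T -> bounded_operator (a *: T).
Proof. by move=> bT; have := bounded_lin a bT (bounded0 H K); rewrite addr0. Qed.

Lemma boundedB H K (S T : H -> K) :
  bounded_operator S -> bounded_operator T -> bounded_operator (S - T).
Proof. by move=> bS bT; rewrite addrC -scaleN1r; apply: bounded_lin. Qed.

Lemma adj_comp H K (L : hilbertType R) (S : K -> L) (T : H -> K) :
  bounded_operator S -> bounded_operator T -> adj (S \o T) = adj T \o adj S.
Proof. by move=> bS bT; apply: adj_eq => x y /=; rewrite !adjP. Qed.

Lemma adj_lin H K (a : R[i]) (S T : H -> K) :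
  bounded_operator S -> bounded_operator T ->
  adj (a *: S + T) = a^* *: adj S + adj T.
Proof.
move=> bS bT; apply: adj_eq => x y; rewrite !fctE.
by rewrite dotDl dotZl dotDr dotZr !adjP.
Qed.

Lemma adj_scale H K (a : R[i]) (T : H -> K) :
  bounded_operator T -> adj (a *: T) = a^* *: adj T.
Proof.
by move=> bT; apply: adj_eq => x y; rewrite !fctE dotZl dotZr adjP.
Qed.

Lemma adj0 H K : adj (0 : H -> K) = 0.
Proof.
apply: adj_eq => x y; change (dot (0 : K) y = dot x (0 : H)).
by rewrite dot0l dot0r.
Qed.

Lemma adj_id H : adj (@id H) = id.
Proof. by apply: adj_eq. Qed.

End Bounded.

Section Dense.
Variables (R : realType).
Implicit Types H K : hilbertType R.

Lemma norm_dense_ext H (S : set H) v : norm_dense S ->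
  (forall s, S s -> rdot s v = 0) -> v = 0.
Proof.
move=> dS h; apply: rdot_ext => y; apply/eqP; rewrite eq_le.
suff key z : rdot z v <= 0 by rewrite key/= -oppr_le0 -rdotNl key.
apply: (@le_of_eps _ _ _ (nrm v)) (nrm_ge0 v) _ => e e0; rewrite add0r.
have [s Ss hs] := dS z e e0.
rewrite -[rdot z v]subr0 -(h s Ss) -rdotNl -rdotDl.
by apply: le_trans (rdot_le _ _) _; rewrite ler_wpM2r ?nrm_ge0 ?ltW.
Qed.

(** The Lipschitz form, rather than a linear one, covers anti-linear maps. *)
Lemma lipschitz_eq H K (S : set H) (f g : H -> K) (c d : R) : norm_dense S ->
  (forall x y, nrm (f x - f y) <= c * nrm (x - y)) ->
  (forall x y, nrm (g x - g y) <= d * nrm (x - y)) ->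
  0 <= c -> 0 <= d -> (forall s, S s -> f s = g s) -> f = g.
Proof.
move=> dS hf hg c0 d0 h; apply/funext => x; apply/eqP.
rewrite -subr_eq0; apply/eqP/nrm0_eq0/eqP; rewrite eq_le nrm_ge0 andbT.
apply: (@le_of_eps _ _ _ (c + d)) => [|e e0]; first by rewrite addr_ge0.
have [s Ss hs] := dS x e e0; rewrite add0r.
have -> : f x - g x = (f x - f s) - (g x - g s).
  by rewrite (h s Ss) opprB addrA subrK.
apply: le_trans (nrmD _ _) _; rewrite nrmN mulrDr.
apply: lerD; [apply: le_trans (hf _ _) _|apply: le_trans (hg _ _) _];
  by rewrite mulrC ler_wpM2r// ltW.
Qed.

Lemma bounded_eq H K (S : set H) (f g : H -> K) : norm_dense S ->
  bounded_operator f -> bounded_operator g -> (forall s, S s -> f s = g s) ->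
  f = g.
Proof.
move=> dS /boundedP[lf [c c0 hc]] /boundedP[lg [d d0 hd]].
by apply: (lipschitz_eq dS) c0 d0 => x y; rewrite -linB.
Qed.

End Dense.

(** * Von Neumann algebras *)

Section VonNeumann.
Variables (R : realType) (H : hilbertType R).
Implicit Types (M S : set (H -> H)) (A B T Y : H -> H).

Section Closure.
Variable M : set (H -> H).
Hypothesis vM : von_neumann_algebra M.

Lemma vna_bounded A : M A -> bounded_operator A.
Proof. by rewrite -(proj2 vM) => -[]. Qed.

Lemma vna_linear A : M A -> linear A.
Proof. by move=> /vna_bounded []. Qed.

(** The form in which the bicommutant theorem is used: membership is tested on
    the commutant. *)
Lemma vna_commute T : bounded_operator T ->
  (forall Y, commutant M Y -> T \o Y = Y \o T) -> M T.
Proof. by move=> bT hT; rewrite -(proj2 vM). Qed.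

Lemma commutantE A Y x : commutant M Y -> M A -> Y (A x) = A (Y x).
Proof. by move=> [_ h] /h/(congr1 (fun f => f x)). Qed.

Lemma vna_adj A : M A -> M (adj A).
Proof. by case: vM => h _; apply: h. Qed.

Lemma vna_id : M id.
Proof. by apply: vna_commute => //; apply: bounded_id. Qed.

Lemma vna_comp A B : M A -> M B -> M (A \o B).
Proof.
move=> MA MB; apply: vna_commute => [|Y hY].
  by apply: bounded_comp; apply: vna_bounded.
by apply/funext => x /=; rewrite (commutantE _ hY MA) (commutantE _ hY MB).
Qed.

Lemma vna_lin (a : R[i]) A B : M A -> M B -> M (a *: A + B).
Proof.
move=> MA MB; apply: vna_commute => [|Y hY].
  by apply: bounded_lin; apply: vna_bounded.
have lY : linear Y by case: hY => -[].
apply/funext => x; rewrite /= !fctE /= lY.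
by rewrite (commutantE _ hY MA) (commutantE _ hY MB).
Qed.

Lemma vna0 : M 0.
Proof.
have := vna_lin (-1) vna_id vna_id; congr M.
by rewrite scaleN1r addNr.
Qed.

Lemma vnaD A B : M A -> M B -> M (A + B).
Proof. by move=> MA /(vna_lin 1 MA); rewrite scale1r. Qed.

Lemma vnaZ (a : R[i]) A : M A -> M (a *: A).
Proof. by move=> /vna_lin/(_ vna0)-/(_ a); rewrite addr0. Qed.

Lemma vnaB A B : M A -> M B -> M (A - B).
Proof. by move=> MA MB; rewrite addrC -scaleN1r; apply: vna_lin. Qed.

End Closure.

Lemma commutant_vna M : (forall A, M A -> M (adj A)) ->
  (forall A, M A -> bounded_operator A) -> von_neumann_algebra (commutant M).
Proof.
move=> Madj Mb; split=> [Y [bY hY]|].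
  split=> [|A MA]; first exact: bounded_adj.
  rewrite -[A]adjK; last exact: Mb.
  have bA := Mb _ (Madj _ MA).
  by rewrite -!adj_comp// hY//; apply: Madj.
apply/seteqP; split=> T [bT hT]; split=> // A.
  by move=> MA; apply: hT; split=> [|Y [bY hY]]; [exact: Mb|rewrite hY].
by move=> [bA hA]; rewrite hA.
Qed.

Lemma vna_commutant M : von_neumann_algebra M -> von_neumann_algebra (commutant M).
Proof.
by move=> vM; apply: commutant_vna => A MA;
  [apply: vna_adj|apply: (vna_bounded vM)].
Qed.

Lemma vna_generated_vna S : (forall A, S A -> bounded_operator A) ->
  von_neumann_algebra (vna_generated S).
Proof.
move=> bS.
have [vB hB] : von_neumann_algebra (commutant [set @id H]) /\
    commutant [set @id H] = @bounded_operator R H H.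
  split; first by apply: commutant_vna => _ ->; rewrite ?adj_id//; apply: bounded_id.
  apply/seteqP; split=> T; first by case.
  by move=> bT; split=> // _ ->.
rewrite hB in vB.
have gb : vna_generated S `<=` @bounded_operator R H H by move=> T; apply.
split=> [A hA N [vN SN]|].
  by apply: vna_adj => //; apply: hA.
apply/seteqP; split=> T.
  move=> [bT hT] N [vN SN]; apply: (vna_commute vN) => // Y [bY hY].
  by apply: hT; split=> // A hA; apply: hY; apply: hA.
by move=> hT; split=> [|Y [_ hY]]; [exact: gb|rewrite hY].
Qed.

Lemma sub_vna_generated S : S `<=` vna_generated S.
Proof. by move=> A SA N [_]; apply. Qed.

End VonNeumann.

(** * Positive operators *)

Section Positive.
Variables (R : realType) (H : hilbertType R).
Implicit Types (A B T : H -> H).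

Lemma op_posP A : op_pos A <->
  forall x, complex.Im (dot x (A x)) = 0 /\ 0 <= rdot x (A x).
Proof. by split=> h x; apply/pos0P. Qed.

Lemma symmetric_of_real A : linear A ->
  (forall z, complex.Im (dot z (A z)) = 0) ->
  forall x y, dot (A x) y = dot x (A y).
Proof.
move=> lA h x y; rewrite dotC.
rewrite (@hermitian_of_real _ _ (fun u v => dot u (A v)) _ _ _ _ h x y) ?conjCK//.
- by move=> u v w; rewrite dotDl.
- by move=> u v w; rewrite (linD lA) dotDr.
- by move=> u v; rewrite dotZl conjCi.
- by move=> u v; rewrite (linZ lA) dotZr.
Qed.

Lemma pos_symmetric A : linear A -> op_pos A ->
  forall x y, dot (A x) y = dot x (A y).
Proof. by move=> lA /op_posP pA; apply: symmetric_of_real => // z; case: (pA z). Qed.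

Lemma selfadjoint_Im A : bounded_operator A -> adj A = A ->
  forall x, complex.Im (dot x (A x)) = 0.
Proof.
move=> bA aA x; have := adjP bA x x; rewrite aA dotC.
by case: (dot x (A x)) => a b [] /=; lra.
Qed.

Lemma op_posD A B : op_pos A -> op_pos B -> op_pos (A + B).
Proof. by move=> pA pB x; rewrite !fctE dotDr addr_ge0. Qed.

Lemma op_le_refl A : op_le A A.
Proof. by move=> x; rewrite !fctE subrr dot0r. Qed.

Lemma op_le_trans B A T : op_le A B -> op_le B T -> op_le A T.
Proof.
move=> AB BT; rewrite /op_le -(subrK B T) -addrA.
by apply: op_posD; rewrite // addrC subrK.
Qed.

Lemma op_le_rdot A B x : op_le A B -> rdot x (A x) <= rdot x (B x).
Proof.
by move=> /op_posP/(_ x) [_]; rewrite !fctE rdotDr rdotNr subr_ge0.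
Qed.

(** Cauchy-Schwarz for the form [<., A .>], obtained from the positivity of the
    form at [x - t A x] with [t = 1/c]. *)
Lemma pos_nrm_sq_le A (c : R) x : linear A -> op_pos A -> 0 <= c ->
  (forall y, rdot y (A y) <= c * nrm y ^+ 2) ->
  nrm (A x) ^+ 2 <= c * rdot x (A x).
Proof.
move=> lA pA c0 hc.
have sA u v : rdot (A u) v = rdot u (A v) by rewrite /rdot pos_symmetric.
have key (t : R) : 2 * t * nrm (A x) ^+ 2 <=
    rdot x (A x) + t ^+ 2 * (c * nrm (A x) ^+ 2).
  have /op_posP/(_ (x - t%:C%C *: A x)) [_] := pA.
  rewrite (linB lA) (linZ lA) !rdotE -(sA x (A x)) !rdotxx.
  have := hc (A x); move: (rdot _ _) (rdot _ _) (nrm _ ^+ 2) => p q r.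
  move=> h1 h2.
  have : t ^+ 2 * q <= t ^+ 2 * (c * r) by rewrite ler_wpM2l ?sqr_ge0.
  by lra.
have [c_eq0|cn0] := eqVneq c 0.
  rewrite c_eq0 mul0r; rewrite c_eq0 in key.
  have r0 : 0 <= rdot x (A x) by case: ((op_posP A).1 pA x).
  rewrite leNgt; apply/negP => n0.
  have := key ((rdot x (A x) + 1) / nrm (A x) ^+ 2).
  rewrite -mulrA divfK ?gt_eqF// mul0r mulr0 addr0 => k.
  by have : (1 : R) <= 0 by [lra]; rewrite ler10.
have cp : 0 < c by rewrite lt0r cn0.
have := key c^-1; rewrite -(ler_pM2l cp).
have -> : c * (2 * c^-1 * nrm (A x) ^+ 2) = 2 * nrm (A x) ^+ 2.
  by field.
have -> : c * (rdot x (A x) + c^-1 ^+ 2 * (c * nrm (A x) ^+ 2)) =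
   c * rdot x (A x) + nrm (A x) ^+ 2 by field.
lra.
Qed.

Lemma pos_eq0 A x : bounded_operator A -> op_pos A -> rdot x (A x) = 0 ->
  A x = 0.
Proof.
move=> /boundedP[lA [c c0 hc]] pA h.
have : nrm (A x) ^+ 2 <= c * rdot x (A x).
  apply: pos_nrm_sq_le => // y; apply: le_trans (rdot_le _ _) _.
  by rewrite expr2 mulrA [c * _]mulrC -mulrA ler_wpM2l ?nrm_ge0.
by rewrite h mulr0 => /sqr_le0_eq0/nrm0_eq0.
Qed.

Lemma op_le_anti A B : bounded_operator A -> bounded_operator B ->
  op_le A B -> op_le B A -> A = B.
Proof.
move=> bA bB AB BA; apply/funext => x; apply/eqP; rewrite eq_sym -subr_eq0; apply/eqP.
apply: (@pos_eq0 (B - A) x) => //; first exact: boundedB.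
have := op_le_rdot x AB; have := op_le_rdot x BA; rewrite !fctE rdotDr rdotNr.
lra.
Qed.

End Positive.

(** * Bounded increasing families of operators *)

Section MonotoneLimits.
Variables (R : realType) (H : hilbertType R).
Implicit Types (A B T : H -> H).

Section Vigier.
Variables (M D : set (H -> H)) (U : H -> H).
Hypotheses (vM : von_neumann_algebra M) (incD : increasing_family M D).
Hypotheses (bU : bounded_operator U) (DU : forall A, D A -> op_le A U).

(** Convergence along the net [D] is expressed by its upper sections. *)
Definition eventually_in (P : (H -> H) -> Prop) :=
  exists2 A, D A & forall B, D B -> op_le A B -> P B.

Lemma eventually_and P Q : eventually_in P -> eventually_in Q ->
  eventually_in (fun B => P B /\ Q B).
Proof.
move=> [A DA hA] [B DB hB]; have [_ _ _ /(_ A B DA DB) [C [DC AC BC]]] := incD.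
exists C => // E DE CE.
by split; [apply: hA|apply: hB] => //;
  [apply: op_le_trans AC CE|apply: op_le_trans BC CE].
Qed.

Lemma eventually_ex P : eventually_in P -> exists2 A, D A & P A.
Proof. by move=> [A DA hA]; exists A => //; apply: hA => //; apply: op_le_refl. Qed.

Let DM A : D A -> M A. Proof. by case: incD => _ h _ _; apply: h. Qed.
Let bD A : D A -> bounded_operator A.
Proof. by move=> /DM; apply: vna_bounded. Qed.
Let lD A : D A -> linear A. Proof. by move=> /bD []. Qed.

(** From some index on, all increments lie between [0] and [U - A0], so that
    [pos_nrm_sq_le] applies to them with one constant [c]. *)
Lemma increment_bound : exists2 A0, D A0 & exists2 c : R, 0 <= c &
  forall A B x, D A -> D B -> op_le A0 A -> op_le A B ->
    nrm (B x - A x) ^+ 2 <= c * (rdot x (B x) - rdot x (A x)) /\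
    nrm (B x - A x) <= c * nrm x.
Proof.
have [[A0 DA0] _ _ _] := incD.
have bUA : bounded_operator (U - A0).
  by apply: boundedB => //; apply: bD.
have [lUA [c c0 hc]] := boundedP bUA.
exists A0 => //; exists c => // A B x DA DB A0A AB.
have lBA : linear (B - A).
  by apply/bounded_linear/boundedB; apply: bD.
have q y : rdot y ((B - A) y) <= c * nrm y ^+ 2.
  have h1 := op_le_rdot y A0A; have h2 := op_le_rdot y (DU DB).
  have := le_trans (rdot_le y ((U - A0) y)) (ler_wpM2l (nrm_ge0 y) (hc y)).
  rewrite !fctE !rdotDr !rdotNr; lra.
have h := pos_nrm_sq_le x lBA AB c0 q.
have e : rdot x ((B - A) x) = rdot x (B x) - rdot x (A x).
  by rewrite !fctE rdotDr rdotNr.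
split; first by rewrite -e.
rewrite -(@ler_pXn2r _ 2)// ?nnegrE ?mulr_ge0 ?nrm_ge0//.
apply: le_trans h _; rewrite exprMn [c ^+ 2]expr2 -mulrA.
by rewrite ler_wpM2l.
Qed.

(** By [increment_bound] the increments of [B x] are controlled by those of the
    bounded increasing family of reals [<x, B x>]. *)
Lemma monotone_cauchy x : exists y, forall e : R, 0 < e ->
  eventually_in (fun B => nrm (B x - y) < e).
Proof.
have [A0 DA0 [c c0 hc]] := increment_bound.
pose E : set R := [set rdot x (A x) | A in D].
have supE : has_sup E.
  split; first by exists (rdot x (A0 x)), A0.
  by exists (rdot x (U x)) => _ [A DA <-]; apply/op_le_rdot/DU.
pose s := sup E.
have sE A : D A -> rdot x (A x) <= s.
  by move=> DA; apply: ub_le_sup; [case: supE | exists A].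
have step (e : R) : 0 < e -> exists A, [/\ D A, op_le A0 A &
    forall B, D B -> op_le A B -> nrm (B x - A x) < e].
  move=> e0; have d0 : 0 < e ^+ 2 / (c + 1).
    by rewrite divr_gt0 ?exprn_gt0// ltr_wpDl.
  have [_ [A DA <-] hA] := sup_adherent d0 supE.
  have [_ _ _ /(_ A0 A DA0 DA) [C [DC A0C AC]]] := incD.
  exists C; split=> // B DB CB; apply: sqr_lt => //; first exact: nrm_ge0.
  have [h _] := hc C B x DC DB A0C CB.
  apply: le_lt_trans h _.
  have h1 := sE B DB; have h2 := op_le_rdot x AC; have h3 := op_le_rdot x CB.
  have c1 : 0 < c + 1 by rewrite ltr_wpDl.
  have h4 : rdot x (B x) - rdot x (C x) < e ^+ 2 / (c + 1).
    by move: hA h1; rewrite -/s; move: (e ^+ 2 / (c + 1)) (s) => i j; lra.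
  apply: (@le_lt_trans _ _ ((c + 1) * (rdot x (B x) - rdot x (C x)))).
    by rewrite ler_wpM2r ?subr_ge0// lerDl.
  by rewrite mulrC -ltr_pdivlMr.
have /choice [u hu] : forall n : nat, exists A, [/\ D A, op_le A0 A &
    forall B, D B -> op_le A B -> nrm (B x - A x) < n.+1%:R^-1].
  by move=> n; apply: step; rewrite invr_gt0 ltr0n.
have [y hy] : exists l, forall e : R, 0 < e -> exists N, forall n, (N <= n)%N ->
     nrm (u n x - l) < e.
  apply: (complete_seq (u := fun n => u n x)) => e e0.
  have [|N hN] := @inv_small R (e / 2); first by rewrite divr_gt0.
  exists N => m n Nm Nn; have [Dm _ hm] := hu m; have [Dn _ hn] := hu n.
  have [_ _ _ /(_ _ _ Dm Dn) [C [DC mC nC]]] := incD.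
  have := hm C DC mC; have := hn C DC nC; have := hN _ Nm; have := hN _ Nn.
  have -> : u m x - u n x = (C x - u n x) - (C x - u m x).
    by rewrite opprB [RHS]addrC subrKA.
  have := nrmD (C x - u n x) (- (C x - u m x)); rewrite nrmN.
  move: (m.+1%:R^-1) (n.+1%:R^-1) => i j; lra.
exists y => e e0.
have e2 : 0 < e / 2 by rewrite divr_gt0.
have [N1 h1] := hy _ e2; have [N2 h2] := inv_small e2.
pose n := maxn N1 N2; have [Dn _ hn] := hu n.
exists (u n) => // B DB nB; have := hn B DB nB.
have := h1 n (leq_maxl _ _); have := h2 n (leq_maxr _ _).
have := nrmD (B x - u n x) (u n x - y); rewrite subrKA.
move: (n.+1%:R^-1) => i; lra.
Qed.

(** The strong limit of [D]; it is below every upper bound of [D], and it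
    belongs to [M] because it commutes with the commutant of [M]. *)
Lemma vigier : exists T, [/\ M T,
  forall x (e : R), 0 < e -> eventually_in (fun B => nrm (B x - T x) < e),
  forall A, D A -> op_le A T
  & forall V, (forall A, D A -> op_le A V) -> op_le T V].
Proof.
have /choice [T hT] := monotone_cauchy.
have lim_le x (k f : R) : (forall e : R, 0 < e ->
    eventually_in (fun B => nrm (B x - T x) < e -> f <= e * k)) -> 0 <= k -> f <= 0.
  move=> h k0; apply: (@le_of_eps _ _ _ k) => // e e0; rewrite add0r.
  have [B DB [h1 h2]] := eventually_ex (eventually_and (h e e0) (hT x e e0)).
  exact: h1.
have lT : linear T.
  move=> a x y; apply/eqP; rewrite -subr_eq0; apply/eqP/nrm0_eq0/eqP.
  rewrite eq_le nrm_ge0 andbT.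
  apply: (@le_of_eps _ _ _ (1 + complex.Re `|a| + 1)) => [|e e0].
    by rewrite !addr_ge0// Re_norm_ge0.
  rewrite add0r.
  have [B DB [h1 [h2 h3]]] := eventually_ex (eventually_and (hT (a *: x + y) e e0)
    (eventually_and (hT x e e0) (hT y e e0))).
  have -> : T (a *: x + y) - (a *: T x + T y) =
     - (B (a *: x + y) - T (a *: x + y)) + (a *: (B x - T x) + (B y - T y)).
    by rewrite (lD DB) scalerBr opprB (addrACA (a *: B x)) subrKA -opprD.
  apply: le_trans (nrmD _ _) _; rewrite nrmN.
  have := nrmD (a *: (B x - T x)) (B y - T y); rewrite nrmZ.
  have : complex.Re `|a| * nrm (B x - T x) <= complex.Re `|a| * e.
    by rewrite ler_wpM2l ?Re_norm_ge0 ?(ltW h2).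
  by move: (complex.Re _) => i; lra.
have [A0 DA0 [c c0 hc]] := increment_bound.
have [lA0 [a a0 ha]] := boundedP (bD DA0).
have bT : bounded_operator T.
  apply: (@boundedI _ _ _ _ (a + c)) => // x.
  rewrite -subr_le0; apply: (@lim_le x 1) => // e e0; exists A0 => // B DB A0B.
  rewrite mulr1 => h.
  have [_ h2] := hc A0 B x DA0 DB (op_le_refl _) A0B.
  have := nrmD (B x - A0 x) (A0 x); rewrite subrK => h3.
  have := nrmD (T x - B x) (B x); rewrite subrK nrmB => h4.
  by have := ha x; lra.
have MT : M T.
  apply: (vna_commute vM) => // Y hY.
  have [lY [d d0 hd]] := boundedP (proj1 hY).
  apply/funext => x /=; apply/eqP; rewrite -subr_eq0; apply/eqP/nrm0_eq0/eqP.
  rewrite eq_le nrm_ge0 andbT.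
  apply: (@le_of_eps _ _ _ (1 + d)) => [|e e0]; first by rewrite addr_ge0.
  rewrite add0r.
  have [B DB [h1 h2]] := eventually_ex (eventually_and (hT (Y x) e e0) (hT x e e0)).
  have -> : T (Y x) - Y (T x) = - (B (Y x) - T (Y x)) + Y (B x - T x).
    by rewrite (linB lY) (commutantE _ hY (DM DB)) opprB addrA subrK.
  apply: le_trans (nrmD _ _) _; rewrite nrmN mulrDr mulr1 lerD ?(ltW h1)//.
  by apply: le_trans (hd _) _; rewrite mulrC ler_wpM2r// ltW.
have TIm x : complex.Im (dot x (T x)) = 0.
  have ImB B : D B -> complex.Im (dot x (B x)) = 0.
    move=> DB; apply: selfadjoint_Im; first exact: bD.
    by case: incD => _ _ h _; apply: h.
  apply/eqP; rewrite -normr_eq0 eq_le normr_ge0 andbT.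
  apply: (@lim_le x (nrm x)) (nrm_ge0 x) => e e0; exists A0 => // B DB _ h.
  have -> : complex.Im (dot x (T x)) = complex.Im (dot x (T x - B x)).
    by rewrite dotBr raddfB /= (ImB B DB) subr0.
  rewrite Im_dot normrN; apply: le_trans (rdot_abs _ _) _.
  by rewrite nrmZ normCi /= mul1r mulrC ler_wpM2r ?nrm_ge0// nrmB ltW.
exists T; split=> // [A DA|V hV].
  apply/op_posP => x; rewrite !fctE dotBr raddfB /= TIm sub0r.
  have [_ _ /(_ A DA) aA _] := incD.
  rewrite (selfadjoint_Im (bD DA) aA) oppr0; split=> //.
  rewrite rdotDr rdotNr subr_ge0 -subr_le0.
  apply: (@lim_le x (nrm x)) (nrm_ge0 x) => e e0; exists A => // B DB AB h.
  have := op_le_rdot x AB; have := rdot_le x (B x - T x); rewrite rdotDr rdotNr.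
  have : nrm x * nrm (B x - T x) <= nrm x * e by rewrite ler_wpM2l ?nrm_ge0// ltW.
  lra.
apply/op_posP => x; rewrite !fctE dotBr raddfB /= TIm subr0; split.
  have := (op_posP _).1 (hV _ DA0) x.
  have [_ _ /(_ A0 DA0) aA0 _] := incD.
  by rewrite !fctE dotBr raddfB /= (selfadjoint_Im (bD DA0) aA0) subr0 => -[].
rewrite rdotDr rdotNr subr_ge0 -subr_le0.
apply: (@lim_le x (nrm x)) (nrm_ge0 x) => e e0; exists A0 => // B DB AB h.
have := op_le_rdot x (hV _ DB); have := rdot_le x (T x - B x).
rewrite rdotDr rdotNr nrmB.
have : nrm x * nrm (B x - T x) <= nrm x * e by rewrite ler_wpM2l ?nrm_ge0// ltW.
lra.
Qed.

End Vigier.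

(** An abstract least upper bound in [M] is the strong limit of the family. *)
Lemma supremum_approx (M D : set (H -> H)) (S : H -> H) :
  von_neumann_algebra M -> increasing_family M D ->
  op_supremum M D S -> forall x (e : R), 0 < e ->
  exists2 A, D A & rdot x (S x) < rdot x (A x) + e.
Proof.
move=> vM incD [MS DS Smin] x e e0.
have bS := vna_bounded vM MS.
have [T [MT lim DT Tmin]] := vigier vM incD bS DS.
have -> : S = T.
  apply: op_le_anti => //; first exact: vna_bounded MT.
    exact: Smin.
  exact: Tmin.
have k0 : 0 < nrm x + 1 by rewrite ltr_wpDl ?nrm_ge0.
have [A DA hA] := eventually_ex (lim x _ (divr_gt0 e0 k0)).
exists A => //; rewrite -ltrBlDl -rdotNr -rdotDr.
apply: le_lt_trans (rdot_le _ _) _; rewrite nrmB.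
apply: (@le_lt_trans _ _ (nrm x * (e / (nrm x + 1)))).
  by rewrite ler_wpM2l ?nrm_ge0 ?ltW.
by rewrite mulrCA gtr_pMr// ltr_pdivrMr// mul1r ltrDl.
Qed.

End MonotoneLimits.

(** * Normality from a separating vector *)

Section States.
Variables (R : realType).
Implicit Types H K : hilbertType R.

(** Let [T] be the supremum of the images.  Then [Phi S - T] is positive, and
    the vector state of [Om'] vanishes on it, because [<Om, S Om>] is the
    supremum of the numbers [<Om, A Om>], which are bounded by [<Om', T Om'>].
    So it kills the separating vector [Om']. *)
Lemma normal_of_state H K (M : set (H -> H)) (Om : H) (N : set (K -> K))
    (Om' : K) (Phi : (H -> H) -> (K -> K)) :
  von_neumann_algebra M -> von_neumann_algebra N -> separating N Om' ->
  (forall A, M A -> N (Phi A)) -> linear_on M Phi ->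
  (forall A, M A -> op_pos A -> op_pos (Phi A)) ->
  (forall A, M A -> Phi (adj A) = adj (Phi A)) ->
  (forall A, M A -> vector_state Om' (Phi A) = vector_state Om A) ->
  normal_map M N Phi.
Proof.
move=> vM vN sepN MN lPhi pPhi aPhi sPhi D S incD supS.
have [MS DS _] := supS; have [[A0 DA0] DM Dsa Ddir] := incD.
have mono A B : M A -> M B -> op_le A B -> op_le (Phi A) (Phi B).
  move=> MA MB AB; rewrite /op_le.
  have -> : Phi B - Phi A = Phi (B - A).
    by rewrite addrC -scaleN1r -lPhi// scaleN1r addrC.
  by apply: pPhi => //; apply: vnaB.
have incP : increasing_family N (Phi @` D).
  split; first by exists (Phi A0), A0.
  - by move=> _ [A DA <-]; apply/MN/DM.
  - by move=> _ [A DA <-]; rewrite -aPhi ?Dsa//; apply: DM.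
  - move=> _ _ [A DA <-] [B DB <-]; have [C [DC AC BC]] := Ddir A B DA DB.
    exists (Phi C); split; first by exists C.
      by apply: mono => //; apply: DM.
    by apply: mono => //; apply: DM.
have NS := MN S MS.
have PU A : (Phi @` D) A -> op_le A (Phi S).
  by move=> [B DB <-]; apply: mono => //; [apply: DM|apply: DS].
have [T [NT _ DT Tmin]] := vigier vN incP (vna_bounded vN NS) PU.
have TS : op_le T (Phi S) by apply: Tmin.
suff -> : Phi S = T by split=> // V _; apply: Tmin.
have NST : N (Phi S - T) by apply: vnaB.
suff h : (Phi S - T) Om' = 0.
  by apply/eqP; rewrite -subr_eq0; apply/eqP/sepN.
apply: pos_eq0 => //; first exact: vna_bounded NST.
apply/eqP; rewrite eq_le; apply/andP; split; last by case: ((op_posP _).1 TS Om').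
apply: (@le_of_eps _ _ _ 1) => // e e0; rewrite add0r mulr1.
have [A DA hA] := supremum_approx vM incD supS Om e0.
have := op_le_rdot Om' (DT (Phi A) (ex_intro2 _ _ A DA erefl)).
have sr B : M B -> rdot Om' (Phi B Om') = rdot Om (B Om).
  by move=> MB; congr complex.Re; apply: sPhi.
rewrite !fctE rdotDr rdotNr !sr//; last exact: DM.
lra.
Qed.

Lemma vector_state_normal_faithful H (M : set (H -> H)) (Om : H) :
  von_neumann_algebra M -> separating M Om -> `|Om| = 1 ->
  normal_faithful_state M (vector_state Om).
Proof.
move=> vM sepM Om1; split.
- by move=> a A B MA MB; rewrite /vector_state !fctE dotDr dotZr.
- by move=> A MA pA; apply: pA.
- by rewrite /vector_state dotxx Om1 expr1n.
- move=> D S incD supS; have [MS DS _] := supS.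
  have [[A0 DA0] DM Dsa _] := incD.
  have re A : D A -> vector_state Om A = (rdot Om (A Om))%:C%C.
    move=> DA; rewrite /vector_state [LHS]complexE.
    rewrite (selfadjoint_Im (vna_bounded vM (DM _ DA)) (Dsa _ DA)).
    by rewrite rmorph0 mulr0 addr0.
  have ub A : D A -> vector_state Om A <= vector_state Om S.
    by move=> DA; have := DS A DA Om; rewrite !fctE dotBr subr_ge0.
  split=> [_ [A DA <-]|z hz]; first exact: ub.
  have := hz _ (ex_intro2 _ _ A0 DA0 erefl); have := ub A0 DA0.
  rewrite (re A0 DA0) !lecE /= => /andP[/eqP -> _] /andP[/eqP -> _].
  rewrite eqxx /=; apply: (@le_of_eps _ _ _ 1) => // e e0; rewrite mulr1.
  have [A DA hA] := supremum_approx vM incD supS Om e0.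
  have := hz _ (ex_intro2 _ _ A DA erefl).
  rewrite (re A DA) lecE /= => /andP[_ hz2].
  by rewrite -/(rdot _ _) ltW// (lt_le_trans hA)// lerD2r.
- move=> A MA pA hA; apply: sepM => //.
  apply: pos_eq0 => //; first exact: vna_bounded MA.
  by rewrite /rdot -[dot _ _]/(vector_state Om A) hA.
Qed.

End States.

(** * Projections onto invariant spaces of pairs *)

Section Pairs.
Variables (R : realType) (H : hilbertType R).
Implicit Types (G : set (H * H)) (a b x u v : H).

Definition complex_subspace G := G (0, 0) /\
  forall (a : R[i]) p q, G p -> G q -> G (a *: p.1 + q.1, a *: p.2 + q.2).

Lemma complex_real_subspace G : complex_subspace G -> real_subspace G.
Proof. by move=> [G0 GD]; split=> // r p q; apply: GD. Qed.

Lemma complex_subspace_closure G : complex_subspace G ->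
  complex_subspace (closure G).
Proof.
move=> [G0 GD]; split; first exact: subset_closure.
move=> a p q /closure_pairP cp /closure_pairP cq; apply/closure_pairP => e e0.
set c := complex.Re `|a|; have c0 : 0 <= c := Re_norm_ge0 a.
have c1 : 0 < c + 1 by rewrite ltr_wpDl.
have d0 : 0 < e / (c + 1) by rewrite divr_gt0.
have [p' Gp [p1 p2]] := cp _ d0; have [q' Gq [q1 q2]] := cq _ d0.
exists (a *: p'.1 + q'.1, a *: p'.2 + q'.2); first exact: GD.
have key (x y x' y' : H) : nrm (x - x') < e / (c + 1) ->
    nrm (y - y') < e / (c + 1) -> nrm (a *: x + y - (a *: x' + y')) < e.
  move=> h1 h2; rewrite opprD addrACA -scalerBr.
  apply: le_lt_trans (nrmD _ _) _; rewrite nrmZ -/c.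
  have h3 : c * nrm (x - x') <= c * (e / (c + 1)) by rewrite ler_wpM2l ?(ltW h1).
  apply: le_lt_trans (lerD h3 (lexx _)) _.
  have eE : c * (e / (c + 1)) + e / (c + 1) = e by field; rewrite gt_eqF.
  by rewrite -[ltRHS]eE ltrD2l.
by split; apply: key.
Qed.

Lemma closure_invariant G (Y : H -> H) : bounded_operator Y ->
  (forall p, G p -> G (Y p.1, Y p.2)) ->
  forall p, closure G p -> closure G (Y p.1, Y p.2).
Proof.
move=> bY GY p /closure_pairP cp; apply/closure_pairP => e e0.
have [lY [c c0 hc]] := boundedP bY.
have c1 : 0 < c + 1 by rewrite ltr_wpDl.
have [q Gq [h1 h2]] := cp _ (divr_gt0 e0 c1).
exists (Y q.1, Y q.2); first exact: GY.
have key x x' : nrm (x - x') < e / (c + 1) -> nrm (Y x - Y x') < e.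
  move=> h; rewrite -(linB lY); apply: le_lt_trans (hc _) _.
  apply: (@le_lt_trans _ _ ((c + 1) * nrm (x - x'))).
    by rewrite ler_wpM2r ?nrm_ge0// lerDl.
  by rewrite mulrC -ltr_pdivlMr.
by split; apply: key.
Qed.

Lemma dot_closure G a b : (forall g, G g -> dot a g.1 = dot b g.2) ->
  forall p, closure G p -> dot a p.1 = dot b p.2.
Proof.
move=> h p /closure_pairP cp; apply/eqP; rewrite -subr_eq0; apply/eqP/Re_norm_le0.
apply: (@le_of_eps _ _ _ (2 * (nrm a + nrm b))) => [|e e0].
  by rewrite mulr_ge0// addr_ge0// nrm_ge0.
have [q Gq [h1 h2]] := cp e e0; rewrite add0r.
have -> : dot a p.1 - dot b p.2 = dot a (p.1 - q.1) - dot b (p.2 - q.2).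
  by rewrite !dotBr (h q Gq) opprB addrA subrK.
suff : `|dot a (p.1 - q.1) - dot b (p.2 - q.2)| <=
    (e * (2 * (nrm a + nrm b)))%:C%C by rewrite lecE => /andP[].
apply: le_trans (ler_normB _ _) _; apply: le_trans (lerD (dot_le _ _) (dot_le _ _)) _.
rewrite -rmorphD lecR.
have : nrm a * nrm (p.1 - q.1) <= nrm a * e by rewrite ler_wpM2l ?nrm_ge0 ?(ltW h1).
have : nrm b * nrm (p.2 - q.2) <= nrm b * e by rewrite ler_wpM2l ?nrm_ge0 ?(ltW h2).
lra.
Qed.

(** [(u, v)] is the orthogonal projection of [(x, 0)] onto the closure of [G]. *)
Definition is_pair_proj G x u v := closure G (u, v) /\
  forall p, closure G p -> dot (x - u) p.1 = dot v p.2.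

Lemma pair_proj_unique G x u v u' v' :
  is_pair_proj G x u v -> is_pair_proj G x u' v' -> u = u' /\ v = v'.
Proof.
move=> [c h] [c' h'].
have : dot (u - u') (u - u') + dot (v - v') (v - v') = 0.
  have e1 := h _ c; have e2 := h _ c'; have e3 := h' _ c; have e4 := h' _ c'.
  move: e1 e2 e3 e4; rewrite /= !dotBl !dotBr => e1 e2 e3 e4.
  by rewrite -e1 -e2 -e3 -e4; ring.
move=> /eqP; rewrite paddr_eq0 ?dot_self_ge0// => /andP[/eqP h1 /eqP h2].
by split; apply/eqP; rewrite -subr_eq0; apply/eqP/dot_self_eq0.
Qed.

Lemma pair_proj_ex G x : complex_subspace G -> exists u v, is_pair_proj G x u v.
Proof.
move=> cG; have [[u v] cu hu] := near_subspace (x, 0) (complex_real_subspace cG).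
exists u, v; split=> //; apply: dot_closure => g Gg.
have key g' : G g' -> rdot (x - u) g'.1 = rdot v g'.2.
  by move=> /hu; rewrite /pdot /= sub0r rdotNl => /eqP; rewrite subr_eq0 => /eqP.
rewrite dot_rdot (dot_rdot v) (key _ Gg).
have := key ('i *: g.1, 'i *: g.2); move=> /= -> //.
by have := cG.2 'i _ _ Gg cG.1; rewrite /= !addr0.
Qed.

(** If [G] is the graph of an operator affiliated with [M], with closure [T] and
    adjoint [T'], the entries [B1] and [B2] are [(1 + T' T)^-1] and
    [T (1 + T' T)^-1]: the projection onto a graph turns an unbounded operator into
    bounded elements of [M]. *)
Lemma pair_proj_in_vna (M : set (H -> H)) G : von_neumann_algebra M ->
  complex_subspace G ->
  (forall Y p, commutant M Y -> G p -> G (Y p.1, Y p.2)) ->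
  exists B1 B2, [/\ M B1, M B2 & forall x, is_pair_proj G x (B1 x) (B2 x)].
Proof.
move=> vM cG GY.
have /choice [B1 /choice [B2 hB]] := fun x => pair_proj_ex x cG.
have cc := complex_subspace_closure cG.
have lB (a : R[i]) x y : B1 (a *: x + y) = a *: B1 x + B1 y /\
    B2 (a *: x + y) = a *: B2 x + B2 y.
  apply: (pair_proj_unique (hB _)); split.
    by have := cc.2 a _ _ (hB x).1 (hB y).1.
  move=> p cp; have := (hB x).2 p cp; have := (hB y).2 p cp.
  rewrite !dotBl !dotDl !dotZl => hy hx.
  by rewrite -hx -hy; ring.
have bnd x : nrm (B1 x) ^+ 2 + nrm (B2 x) ^+ 2 <= nrm x ^+ 2.
  have := (hB x).2 _ (hB x).1 => /= /(congr1 (@complex.Re R)).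
  rewrite -!/(rdot _ _) rdotDl rdotNl !rdotxx => h.
  have := nrm_sqB x (B1 x); have := sqr_ge0 (nrm (x - B1 x)).
  have := sqr_ge0 (nrm (B2 x)); lra.
have b1 : bounded_operator B1.
  apply: (@boundedI _ _ _ _ 1) => [a x y|x]; first by case: (lB a x y).
  rewrite mul1r -(@ler_pXn2r _ 2)// ?nnegrE ?nrm_ge0//.
  by apply: le_trans (bnd x); rewrite lerDl sqr_ge0.
have b2 : bounded_operator B2.
  apply: (@boundedI _ _ _ _ 1) => [a x y|x]; first by case: (lB a x y).
  rewrite mul1r -(@ler_pXn2r _ 2)// ?nnegrE ?nrm_ge0//.
  by apply: le_trans (bnd x); rewrite lerDr sqr_ge0.
have comm Y x : commutant M Y -> B1 (Y x) = Y (B1 x) /\ B2 (Y x) = Y (B2 x).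
  move=> hY; have bY : bounded_operator Y by case: hY.
  have [lY _] := bY; apply: (pair_proj_unique (hB _)); split.
    by apply: (closure_invariant bY (fun p => GY Y p hY) (hB x).1).
  move=> p cp; rewrite -(linB lY) !(adjP bY).
  have hY' : commutant M (adj Y) by apply: (vna_adj (vna_commutant vM)).
  by have := (hB x).2 _ (closure_invariant (proj1 hY') (fun p => GY _ p hY') cp).
exists B1, B2; split=> //.
  by apply: vna_commute => // Y hY; apply/funext => x /=; case: (comm Y x hY).
by apply: vna_commute => // Y hY; apply/funext => x /=; case: (comm Y x hY).
Qed.

End Pairs.

Lemma selfadjoint_parts (R : realType) (H : hilbertType R)
    (M : set (H -> H)) A : von_neumann_algebra M -> M A ->
  exists B C, [/\ M B, M C, adj B = B, adj C = C &
    A = B + 'i *: C /\ adj A = B - 'i *: C].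
Proof.
move=> vM MA; have MA' := vna_adj vM MA.
have bA := vna_bounded vM MA; have bA' := vna_bounded vM MA'.
have ii : 'i * 'i = -1 :> R[i] by rewrite -expr2 sqrCi.
have half (z : H) : (2^-1 : R[i]) *: z + (2^-1 : R[i]) *: z = z.
  by rewrite -scalerDl [_ + _](_ : _ = 1) ?scale1r//; field.
have conj2 : (2^-1 : R[i])^* = 2^-1 by rewrite conj_Creal// realV realn.
exists ((2^-1 : R[i]) *: A + (2^-1 : R[i]) *: adj A).
exists ((- 'i / 2) *: A + ('i / 2) *: adj A).
have i2 : ('i / 2 : R[i])^* = - 'i / 2 by rewrite rmorphM /= conj2 conjCi.
have i3 : (- 'i / 2 : R[i])^* = 'i / 2 by rewrite -i2 conjCK.
split.
- by apply: (vna_lin vM) => //; apply: (vnaZ vM).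
- by apply: (vna_lin vM) => //; apply: (vnaZ vM).
- rewrite adj_lin//; try exact: boundedZ.
  by rewrite adj_scale// adjK// conj2 addrC.
- rewrite adj_lin//; try exact: boundedZ.
  by rewrite adj_scale// adjK// i2 i3 addrC.
split; apply/funext => x; rewrite !fctE scalerDr !scalerA !mulrA ?mulrN ii.
  rewrite opprK mul1r mulN1r scaleNr addrACA half.
  by rewrite subrr addr0.
rewrite opprK mul1r mulN1r scaleNr opprD opprK addrACA subrr add0r half.
by [].
Qed.

(** * The real density theorem of Rieffel and van Daele *)

Section Commutant.
Variables (R : realType) (H : hilbertType R) (M : set (H -> H)) (Om : H).
Hypotheses (vM : von_neumann_algebra M) (sepM : separating M Om).

Let vM' := vna_commutant vM.

(** The projection onto the closure of the orbit of [Om] is an element of [M]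
    that fixes [Om], so it is the identity as [Om] is separating. *)
Lemma commutant_dense : norm_dense [set Y Om | Y in commutant M].
Proof.
move=> x e e0.
pose G : set (H * H) := [set p | exists2 Y, commutant M Y & p = (Y Om, 0)].
have cG : complex_subspace G.
  split; first by exists 0 => //; apply: vna0.
  move=> a _ _ [Y hY ->] [Z hZ ->]; exists (a *: Y + Z).
    exact: vna_lin.
  by rewrite /= scaler0 addr0 !fctE.
have GY Y p : commutant M Y -> G p -> G (Y p.1, Y p.2).
  move=> hY [Z hZ ->]; exists (Y \o Z); first exact: (vna_comp vM').
  by rewrite /= (lin0 (vna_linear vM' hY)).
have [B1 [B2 [MB1 MB2 hB]]] := pair_proj_in_vna vM cG GY.
have BOm : B1 Om = Om.
  have [|//] := pair_proj_unique (hB Om) (_ : is_pair_proj G Om Om 0).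
  split=> [|p _]; last by rewrite subrr !dot0l.
  by apply: subset_closure; exists id => //; apply: vna_id.
have B1id : B1 - id = 0.
  by apply: sepM; [apply: vnaB => //; apply: vna_id|rewrite !fctE BOm subrr].
have B1x : B1 x = x.
  by apply/eqP; rewrite -subr_eq0; apply/eqP/(congr1 (fun f => f x) B1id).
have [/closure_pairP/(_ e e0) [_ [Y hY ->] [h _]] _] := hB x.
by exists (Y Om); [exists Y|rewrite -{1}B1x].
Qed.

(** Orthogonality to the vectors [i Y Om] says that [Y Om |-> Y xi], for [Y] in
    the commutant, is a symmetric operator.  Its closure [T] is affiliated with
    [M], and [T Om = xi].  Let [B] be [T (1 + T' T)^-1], with [T'] the adjoint of
    [T]; it belongs to [M] by [pair_proj_in_vna].  The orthogonality of [xi] to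
    [(B + adj B) Om] is the vanishing of a sum of two nonnegative numbers, and one
    of them controls the distance of [(Om, 0)] to its projection.  So [(Om, 0)]
    lies in the graph of [T], whence [xi = 0] by symmetry. *)
Lemma real_density xi :
  (forall A, M A -> adj A = A -> rdot xi (A Om) = 0) ->
  (forall Y, commutant M Y -> adj Y = Y -> rdot xi ('i *: Y Om) = 0) ->
  xi = 0.
Proof.
move=> hA hY.
have bM A : M A -> bounded_operator A by apply: vna_bounded.
have sym Y : commutant M Y -> dot (Y Om) xi = dot (Y xi) Om.
  move=> MY; have [B [C [MB MC aB aC [-> adjY]]]] := selfadjoint_parts vM' MY.
  have re Z : commutant M Z -> adj Z = Z -> dot (Z Om) xi = dot xi (Z Om).
    move=> MZ aZ; rewrite dotC; have := hY Z MZ aZ.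
    rewrite -[rdot _ _]opprK -Im_dot; case: (dot xi (Z Om)) => a b /= /eqP.
    by rewrite oppr_eq0 => /eqP ->; apply/eqP; rewrite eq_complex /= oppr0 !eqxx.
  have bB := proj1 MB; have bC := proj1 MC.
  rewrite !fctE dotDl dotZl (re B)// (re C)// dotDl dotZl.
  by rewrite (adjP bB) (adjP bC) aB aC.
pose G : set (H * H) := [set p | exists2 Y, commutant M Y & p = (Y Om, Y xi)].
have cG : complex_subspace G.
  split; first by exists 0 => //; apply: (vna0 vM').
  move=> a _ _ [Y hY1 ->] [Z hZ ->]; exists (a *: Y + Z) => //.
  exact: (vna_lin vM').
have GY Y p : commutant M Y -> G p -> G (Y p.1, Y p.2).
  by move=> hY1 [Z hZ ->]; exists (Y \o Z) => //; apply: (vna_comp vM').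
have symG u v Y : commutant M Y -> closure G (u, v) ->
    dot (Y xi) u = dot (Y Om) v.
  move=> MY; apply: (@dot_closure _ _ G) => _ [Z MZ ->] /=.
  have MYa := vna_adj vM' MY; have bY := proj1 MY; have bZ := proj1 MZ.
  have := sym _ (vna_comp vM' (vna_adj vM' MZ) MY).
  by rewrite /= (adjPr bZ) => ->; rewrite (adjPr bZ).
have [B1 [B [MB1 MB hB]]] := pair_proj_in_vna vM cG GY.
have GOm : closure G (Om, xi).
  by apply: subset_closure; exists id => //; apply: (vna_id vM').
have bB := bM _ MB.
(* both summands are nonnegative, by e1 and e2 below, hence zero *)
have h0 : rdot xi (B Om) + rdot (B xi) Om = 0.
  have MB' := vna_adj vM MB.
  have aBB : adj (B + adj B) = B + adj B.
    have := adj_lin 1 bB (bounded_adj bB).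
    by rewrite adjK// conjC1 !scale1r addrC => ->; rewrite addrC.
  have := hA _ (vnaD vM MB MB') aBB.
  by rewrite [(B + adj B) Om]/(B Om + adj B Om) rdotDr {2}/rdot -(adjP bB).
set u := B1 Om; set v := B Om.
have e1 : dot v xi = dot (Om - u) (Om - u) + dot v v.
  have /= <- := (hB Om).2 _ GOm; have /= <- := (hB Om).2 _ (hB Om).1.
  by rewrite -/u -dotDr subrK.
have e2 : dot (B xi) Om = dot (B1 xi) (B1 xi) + dot (B xi) (B xi).
  have q : dot xi (B1 xi) = dot (B1 xi) (B1 xi) + dot (B xi) (B xi).
    by have /= <- := (hB xi).2 _ (hB xi).1; rewrite -dotDl addrC subrK.
  have s := symG (B1 xi) (B xi) id (vna_id vM') (hB xi).1.
  by rewrite dotC -s q !dot_nrm -rmorphD conj_Creal ?complex_real ?eqxx.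
have r1 : rdot xi v = nrm (Om - u) ^+ 2 + nrm v ^+ 2.
  by rewrite rdotC /rdot e1 raddfD /= -!/(rdot _ _) !rdotxx.
have r2 : 0 <= rdot (B xi) Om.
  by rewrite /rdot e2 raddfD /= -!/(rdot _ _) !rdotxx addr_ge0 ?sqr_ge0.
have u0 : u = Om.
  apply/eqP; rewrite eq_sym -subr_eq0; apply/eqP/nrm0_eq0/sqr_le0_eq0.
  by have := sqr_ge0 (nrm v); lra.
have v0 : v = 0.
  by apply/nrm0_eq0/sqr_le0_eq0; have := sqr_ge0 (nrm (Om - u)); lra.
have cOm : closure G (Om, 0) by rewrite -u0 -v0; apply: (hB Om).1.
apply: (norm_dense_ext commutant_dense) => _ [Y MY <-].
have MYa := vna_adj vM' MY.
have := symG _ _ _ MYa cOm; rewrite dot0r (adjPr (proj1 MY)) => h.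
by rewrite rdotC /rdot h.
Qed.

End Commutant.

(** * Anti-unitary operators *)

Section Antiunitary.
Variables (R : realType) (H : hilbertType R) (J : H -> H).
Hypothesis antiJ : antiunitary J.

Lemma antiP (a : R[i]) x y : J (a *: x + y) = a^* *: J x + J y.
Proof. by case: antiJ. Qed.

Lemma antiD x y : J (x + y) = J x + J y.
Proof. by rewrite -[x in LHS]scale1r antiP conjC1 scale1r. Qed.

Lemma anti0 : J 0 = 0.
Proof. by apply: (addrI (J 0)); rewrite -antiD !addr0. Qed.

Lemma antiZ (a : R[i]) x : J (a *: x) = a^* *: J x.
Proof. by rewrite -[a *: x]addr0 antiP anti0 addr0. Qed.

Lemma antiB x y : J (x - y) = J x - J y.
Proof. by rewrite antiD -scaleN1r antiZ conjCN1 scaleN1r. Qed.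

Lemma anti_dot x y : dot (J x) (J y) = dot y x.
Proof. by case: antiJ. Qed.

Lemma anti_nrm x : nrm (J x) = nrm x.
Proof.
apply/eqP; rewrite -(@eqrXn2 _ 2)// ?nrm_ge0//; apply/eqP.
by rewrite -!rdotxx /rdot anti_dot.
Qed.

Lemma antiadjP x y : dot (J x) y = dot (antiadj J y) x.
Proof.
have ex : exists S : H -> H, forall x y, dot (J x) y = dot (S y) x.
  have /choice [S hS] : forall y, exists x, J x = y by case: antiJ.
  by exists S => u v; rewrite -{1}(hS v) anti_dot.
exact: (@getPex _ [set S : H -> H | forall x y, dot (J x) y = dot (S y) x] ex).
Qed.

Lemma antiadjK x : antiadj J (J x) = x.
Proof.
by apply: dot_ext => y; rewrite dotC -antiadjP anti_dot -dotC.
Qed.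

Lemma antiadjKr y : J (antiadj J y) = y.
Proof.
have [_ _ /(_ y) [x <-]] := antiJ; by rewrite antiadjK.
Qed.

Lemma antiunitary_antiadj : antiunitary (antiadj J).
Proof.
split=> [a x y|x y|y].
- rewrite -{1}[x]antiadjKr -{1}[y]antiadjKr -{1}[a]conjCK.
  by rewrite -antiP antiadjK.
- by rewrite -antiadjP antiadjKr.
- by exists (J y); rewrite antiadjK.
Qed.

Lemma anti_conj_bounded (T : H -> H) (J' : H -> H) : antiunitary J' ->
  bounded_operator T -> bounded_operator (J' \o T \o J).
Proof.
move=> aJ' /boundedP[lT [c c0 hc]]; have [pJ' dJ' _] := aJ'.
apply: (@boundedI _ _ _ _ c) => [a x y|x] /=.
  by rewrite antiP lT pJ' conjCK.
have nJ' z : nrm (J' z) = nrm z.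
  apply/eqP; rewrite -(@eqrXn2 _ 2)// ?nrm_ge0//; apply/eqP.
  by rewrite -!rdotxx /rdot dJ'.
by rewrite nJ' -(anti_nrm x).
Qed.

End Antiunitary.

(** * The modular conjugation *)

Section Modular.
Variables (R : realType) (H : hilbertType R) (M : set (H -> H)) (Om : H).
Variable J : H -> H.
Hypotheses (vM : von_neumann_algebra M) (modJ : modular_conjugation M Om J).

Let antiJ : antiunitary J. Proof. by case: modJ. Qed.
Let Ji := antiadj J.
Let antiJi : antiunitary Ji. Proof. exact: antiunitary_antiadj. Qed.

Lemma tomita_graph A : M A -> tomita_operator M Om (A Om, adj A Om).
Proof. by move=> MA; apply: subset_closure; exists A. Qed.

Lemma tomita_swap u w : tomita_operator M Om (u, w) -> tomita_operator M Om (w, u).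
Proof.
move=> /closure_pairP h; apply/closure_pairP => e e0.
have [_ [A MA <-] [/= h1 h2]] := h e e0.
exists (adj A Om, adj (adj A) Om); first by exists (adj A) => //; apply: vna_adj.
by rewrite adjK//; apply: vna_bounded MA.
Qed.

Lemma tomita_dot_Om u w : tomita_operator M Om (u, w) -> dot Om u = dot w Om.
Proof.
move=> /closure_pairP h; apply/eqP; rewrite -subr_eq0; apply/eqP/Re_norm_le0.
apply: (@le_of_eps _ _ _ (4 * nrm Om)) => [|e e0]; first by rewrite mulr_ge0 ?nrm_ge0.
have [_ [A MA <-] [/= h1 h2]] := h e e0; rewrite add0r.
have bA := vna_bounded vM MA.
have -> : dot Om u - dot w Om = dot Om (u - A Om) - dot (w - adj A Om) Om.
  by rewrite dotBr dotBl (adjPr bA) opprB addrA subrK.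
suff : `|dot Om (u - A Om) - dot (w - adj A Om) Om| <=
    (e * (4 * nrm Om))%:C%C by rewrite lecE => /andP[].
apply: le_trans (ler_normB _ _) _; apply: le_trans (lerD (dot_le _ _) (dot_le _ _)) _.
rewrite -rmorphD lecR.
have : nrm Om * nrm (u - A Om) <= nrm Om * e by rewrite ler_wpM2l ?nrm_ge0 ?(ltW h1).
have : nrm (w - adj A Om) * nrm Om <= e * nrm Om.
  by rewrite ler_wpM2r ?nrm_ge0 ?(ltW h2).
lra.
Qed.

(** [D] is the positive part of the polar decomposition, that is, the square
    root of the modular operator. *)
Variable D : set (H * H).
Hypotheses (posD : positive_selfadjoint D)
  (polarD : tomita_operator M Om = [set (p.1, J p.2) | p in D]).

Lemma polarP u v : D (u, v) <-> tomita_operator M Om (u, J v).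
Proof.
rewrite polarD; split=> [Duv|[[u' v'] D' /= [<- /(congr1 Ji)]]].
  by exists (u, v).
by rewrite /Ji !antiadjK// => <-.
Qed.

(** The Tomita operator is its own inverse. *)
Lemma polar_swap u v : D (u, v) -> D (J v, Ji u).
Proof. by move=> /polarP/tomita_swap h; apply/polarP; rewrite antiadjKr. Qed.

Lemma polar_dom A : M A -> D (A Om, Ji (adj A Om)).
Proof. by move=> MA; apply/polarP; rewrite antiadjKr//; apply: tomita_graph. Qed.

Lemma polar_lin (a : R[i]) p q : D p -> D q -> D (a *: p.1 + q.1, a *: p.2 + q.2).
Proof.
have [_ <- _] := posD => hp hq r Dr /=.
by rewrite !dotDl !dotZl (hp r Dr) (hq r Dr).
Qed.

Lemma polar_sym p q : D p -> D q -> dot p.2 q.1 = dot p.1 q.2.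
Proof.
move=> Dp Dq; have [_ gD _] := posD.
have h : graph_adj D p by rewrite gD.
exact: h.
Qed.

Lemma JiE x y : dot (Ji x) y = dot (J y) x.
Proof. by rewrite /Ji -antiadjP. Qed.

Lemma JJ_adj x y : dot (Ji (Ji x)) y = dot x (J (J y)).
Proof. by rewrite JiE (dotC _ x) (antiadjP antiJ (J y) x) -dotC. Qed.

(** The unitary [W = J J] satisfies [D W^-1 = W D]: the relation is checked on
    the pairs [polar_swap q], which exhaust [D], and [D] is its own adjoint. *)
Lemma polar_shift u v : D (u, v) -> D (Ji (Ji u), J (J v)).
Proof.
move=> Duv; have [_ <- _] := posD => q Dq /=.
have Dq' : D (J q.2, Ji q.1) by apply: polar_swap; case: q Dq.
have h := polar_sym (polar_swap Duv) Dq'.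
by rewrite (antiadjP antiJ) JiE dotC -[antiadj J q.1]/(Ji q.1) -h -dotC.
Qed.

Lemma polar_iter n u v : D (u, v) ->
  D (iter n (Ji \o Ji) u, iter n (J \o J) v).
Proof. by move=> Duv; elim: n => //= n; apply: polar_shift. Qed.

Lemma iter_adj n x y : dot (iter n (Ji \o Ji) x) y = dot x (iter n (J \o J) y).
Proof.
elim: n x y => //= n IHn x y; rewrite JJ_adj IHn.
by congr (dot x _); symmetry; apply: (iterSr n (J \o J)).
Qed.

Lemma iter_nrm n x : nrm (iter n (J \o J) x) = nrm x.
Proof. by elim: n => //= n IHn; rewrite !(anti_nrm antiJ). Qed.

(** Positivity of [D] at [W^-n u - u]. *)
Lemma polar_square_ge n u v : D (u, v) ->
  0 <= rdot u v - 2 * rdot u (iter n (J \o J) v) +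
       rdot u (iter (n + n) (J \o J) v).
Proof.
move=> Duv; have [_ _ pD] := posD.
have := pD _ (polar_lin (- 1) (polar_iter n Duv) Duv).
rewrite /= !scaleN1r => /pos0P[_]; rewrite -/(rdot _ _) !rdotE.
have ra x y : rdot (iter n (Ji \o Ji) x) y = rdot x (iter n (J \o J) y).
  by rewrite /rdot iter_adj.
by rewrite !ra -iterD; lra.
Qed.

(** The sequence [<u, W^(2n) v>] is convex by [polar_square_ge] and bounded, so
    its second term is at most the first; convexity at [0, 1, 2] then bounds
    [<u, W v>].  Only even terms are compared because
    [polar_shift] moves both entries of a pair. *)
Lemma polar_decr u v : D (u, v) -> rdot u (J (J v)) <= rdot u v.
Proof.
move=> Duv.
pose c n := rdot u (iter (n + n) (J \o J) v).
have : c 1%N <= c 0%N.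
  apply: (@convex_bounded_le _ _ (nrm u * nrm v)) => n; last first.
    by apply: le_trans (rdot_le _ _) _; rewrite iter_nrm.
  have := polar_square_ge 2 (polar_iter n Duv).
  rewrite /rdot !iter_adj -!/(rdot _ _) -!iterD.
  have -> : (n + 2 + n = n.+1 + n.+1)%N by rewrite addn2 !addSn addnS.
  have -> // : (n + (2 + 2) + n = n.+2 + n.+2)%N.
  by rewrite !addnA !addn2 !addSn !addnS.
have := polar_square_ge 1 Duv.
by rewrite /c /=; lra.
Qed.

(** The swapped pair exchanges the two sides of [polar_decr]. *)
Lemma polar_fixed u v : D (u, v) -> rdot u (J (J v)) = rdot u v.
Proof.
move=> Duv; apply/eqP; rewrite eq_le polar_decr//=.
have := polar_decr (polar_swap Duv).
by rewrite /Ji (antiadjKr antiJ) /rdot anti_dot// (antiadjP antiJ v) JJ_adj.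
Qed.

(** Polarizing [polar_fixed] shows that [W = 1] on the range of [D], which is
    dense because it is the image under [Ji] of the domain of [D]. *)
Lemma modular_conjugation_antiadj : J = Ji.
Proof.
have [domD _ _] := posD.
have dD : norm_dense [set p.1 | p in D] by apply/denseP.
have fix2 p : D p -> J (J p.2) = p.2.
  move=> Dp; apply/eqP; rewrite -subr_eq0; apply/eqP/(norm_dense_ext dD).
  move=> _ [q Dq <-].
  have sym : rdot q.1 (J (J p.2)) = rdot p.1 (J (J q.2)).
    have Dq' : D (Ji (Ji q.1), J (J q.2)) by apply: polar_shift; case: q Dq.
    by rewrite rdotC /rdot dotC -JJ_adj -(polar_sym Dq' Dp) dotC conjCK
      -/(rdot _ _) rdotC.
  have sym0 : rdot q.1 p.2 = rdot p.1 q.2.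
    by rewrite [RHS]rdotC /rdot (polar_sym Dq Dp).
  have Dpq := polar_lin 1 Dp Dq; rewrite !scale1r in Dpq.
  have := polar_fixed Dpq; rewrite !(antiD antiJ) !rdotE.
  have := polar_fixed (u := p.1) (v := p.2); have := polar_fixed (u := q.1) (v := q.2).
  rewrite -!surjective_pairing => /(_ Dq) -> /(_ Dp) ->; rewrite sym sym0.
  lra.
have e p : D p -> J p.1 = Ji p.1.
  move=> Dp; have := fix2 _ (polar_swap (u := p.1) (v := p.2) _).
  by rewrite -surjective_pairing => /(_ Dp) /=; rewrite (antiadjKr antiJ).
apply: (lipschitz_eq (c := 1) (d := 1) dD) => // [x y|x y|_ [p Dp <-]].
- by rewrite -(antiB antiJ) anti_nrm// mul1r.
- by rewrite -(antiB antiJi) anti_nrm// mul1r.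
- exact: e.
Qed.

Lemma conjugationK x : J (J x) = x.
Proof. by have := antiadjK antiJ x; rewrite -/Ji -modular_conjugation_antiadj. Qed.

(** Both [(Om, J Om)] and [(J Om, Om)] belong to [D]; the difference of the two
    pairs is of the form [(- x, x)], so [x = 0] by positivity. *)
Lemma conjugation_Om : J Om = Om.
Proof.
have D1 : D (Om, J Om).
  have := polar_dom (vna_id vM).
  by rewrite adj_id -modular_conjugation_antiadj.
have D2 : D (J Om, Om).
  have [_ <- _] := posD => -[u v] Duv /=.
  have /tomita_dot_Om -> := (polarP u v).1 Duv.
  by rewrite -[in RHS](conjugationK v) (anti_dot antiJ).
have := polar_lin (-1) D2 D1; rewrite /= !scaleN1r => D3.
have [_ _ /(_ _ D3)] := posD; rewrite /= => h.
have : dot (Om - J Om) (Om - J Om) = 0.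
  apply/eqP; rewrite eq_le dot_self_ge0 andbT.
  by rewrite -oppr_ge0 -dotNr opprB; move: h; congr (0 <= dot _ _); rewrite addrC.
by move=> /dot_self_eq0/eqP; rewrite subr_eq0 => /eqP <-.
Qed.

(** Here [D] maps [A Om] to [J (A Om)]; the claim is the symmetry of [D],
    transported by [J]. *)
Lemma conjugation_real A B : M A -> M B -> adj A = A -> adj B = B ->
  rdot (A Om) ('i *: J (B Om)) = 0.
Proof.
move=> MA MB aA aB.
have DA := polar_dom MA; have DB := polar_dom MB.
rewrite aA -modular_conjugation_antiadj in DA.
rewrite aB -modular_conjugation_antiadj in DB.
have /= h := polar_sym DA DB.
have : complex.Im (dot (A Om) (J (B Om))) = 0.
  apply: conj_eq_Im0.
  by rewrite -dotC -h -{1}[B Om]conjugationK (anti_dot antiJ).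
by rewrite Im_dot => /eqP; rewrite oppr_eq0 => /eqP.
Qed.

End Modular.

(** * Commutation of an algebra with its conjugate *)

Section TomitaCommutation.
Variables (R : realType) (H : hilbertType R) (M : set (H -> H)) (Om : H).
Variable J : H -> H.
Hypotheses (vM : von_neumann_algebra M) (sepM : separating M Om).
Hypotheses (antiJ : antiunitary J) (JK : forall x, J (J x) = x)
  (JOm : J Om = Om).
Hypothesis Jreal : forall A B, M A -> M B -> adj A = A -> adj B = B ->
  rdot (A Om) ('i *: J (B Om)) = 0.
Hypothesis JMJ : forall Y, commutant M Y -> M (J \o Y \o J).

Let vM' := vna_commutant vM.

(** Approximate [i J A Om] by [B Om + i Y Om] with the density theorem.  The term
    [B Om] is orthogonal to both other terms, so dropping it only improves the
    approximation. *)
Lemma conjugate_approx A (e : R) : M A -> adj A = A -> 0 < e ->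
  exists Y, [/\ commutant M Y, adj Y = Y & nrm (J (A Om) - Y Om) < e].
Proof.
move=> MA aA e0.
pose G : set H := [set x | exists B Y, [/\ M B /\ adj B = B,
  commutant M Y /\ adj Y = Y & x = B Om + 'i *: Y Om]].
have saD (N : set (H -> H)) (r : R) B C : von_neumann_algebra N ->
    N B /\ adj B = B -> N C /\ adj C = C ->
    N (r%:C%C *: B + C) /\ adj (r%:C%C *: B + C) = r%:C%C *: B + C.
  move=> vN [NB aB] [NC aC]; split; first exact: vna_lin.
  rewrite adj_lin; [|exact: vna_bounded NB|exact: vna_bounded NC].
  by rewrite aB aC conj_Creal ?complex_real.
have sG : real_subspace1 G.
  split.
    exists 0, 0; split; [by split; [apply: vna0|apply: adj0]| |].
      by split; [apply: (vna0 vM')|apply: adj0].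
    by change (0 = 0 + 'i *: (0 : H)); rewrite scaler0 addr0.
  move=> r _ _ [B [Y [hB hY ->]]] [C [Z [hC hZ ->]]].
  exists (r%:C%C *: B + C), (r%:C%C *: Y + Z); split; try exact: saD.
  rewrite !fctE !scalerDr addrACA !scalerA [r%:C%C * 'i]mulrC //.
have [|g [B [Y [[MB aB] [MY aY] ->]]] hg] :=
    dense_of_orthogonal sG _ ('i *: J (A Om)) e0.
  move=> xi hxi; apply: (real_density vM sepM) => [B MB aB|Y MY aY]; apply: hxi.
    exists B, 0; split=> //; first by split; [apply: (vna0 vM')|apply: adj0].
    by change (B Om = B Om + 'i *: (0 : H)); rewrite scaler0 addr0.
  exists 0, Y; split=> //; first by split; [apply: vna0|apply: adj0].
  by change ('i *: Y Om = (0 : H) + 'i *: Y Om); rewrite add0r.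
exists Y; split=> //; apply: le_lt_trans hg.
have ort1 := Jreal MB MA aB aA.
have ort2 : rdot (B Om) ('i *: Y Om) = 0.
  apply/eqP; rewrite -oppr_eq0 -Im_dot conj_eq_Im0// -dotC.
  have bY := proj1 MY; have bB := vna_bounded vM MB.
  by rewrite (adjP bY) -{1}aB (adjPr bB) aY (commutantE _ MY MB).
rewrite -(@ler_pXn2r _ 2)// ?nnegrE ?nrm_ge0//.
have -> : 'i *: J (A Om) - (B Om + 'i *: Y Om) = 'i *: (J (A Om) - Y Om) - B Om.
  by rewrite scalerBr opprD addrCA addrC.
rewrite [leRHS]nrm_sqB scale_i_nrm (rdotC _ (B Om)) scalerBr rdotDr rdotNr ort1 ort2.
by rewrite subrr mulr0 subr0 lerDl sqr_ge0.
Qed.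

(** Let [y = J B J].  For every [z = x Om] with [x] self-adjoint in [J M' J], the
    numbers [<y1 Om, y y2 z>] and [<y1 z, y y2 Om>] agree, as [x] commutes with
    [y], [y1] and [y2].  Both sides depend continuously on [z], so they agree at
    [z = A Om] by [conjugate_approx], and this says that [A] and [y] commute on a
    dense set. *)
Lemma conj_commutes A B : M A -> adj A = A -> M B ->
  forall x, J (B (J (A x))) = A (J (B (J x))).
Proof.
move=> MA aA MB.
have bA := vna_bounded vM MA; have bB := vna_bounded vM MB.
pose y := J \o B \o J.
have by_ : bounded_operator y by apply: anti_conj_bounded.
have [ly [c c0 hc]] := boundedP by_.
have dM' := commutant_dense vM sepM.
have key y1 y2 : commutant M y1 -> commutant M y2 ->
    rdot (y1 Om) (y (A (y2 Om))) = rdot (y1 Om) (A (y (y2 Om))).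
  move=> M1 M2; have [b1 _] := M1; have [b2 _] := M2.
  have [l1 [c1 c10 h1]] := boundedP b1; have [l2 [c2 c20 h2]] := boundedP b2.
  pose E z := rdot (y1 Om) (y (y2 z)) - rdot (y1 z) (y (y2 Om)).
  have -> : rdot (y1 Om) (A (y (y2 Om))) = rdot (y1 (A Om)) (y (y2 Om)).
    by rewrite (commutantE _ M1 MA) /rdot (adjP bA) aA.
  rewrite -(commutantE _ M2 MA); apply/eqP; rewrite -subr_eq0 -/(E (A Om)).
  have EB z w : E z - E w = E (z - w).
    by rewrite /E (linB l2) (linB ly) (linB l1) !rdotE; ring.
  rewrite -normr_eq0 eq_le normr_ge0 andbT.
  apply: (@le_of_eps _ _ _ (nrm (y1 Om) * (c * c2) + c1 * nrm (y (y2 Om)))).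
    by rewrite addr_ge0// !mulr_ge0// nrm_ge0.
  move=> e e0; rewrite add0r.
  have [Y [MY aY hY]] := conjugate_approx MA aA e0.
  pose x := J \o Y \o J.
  have Mx : M x by apply: JMJ.
  have bY := proj1 MY.
  have xOm : x Om = J (Y Om) by rewrite /x /= JOm.
  have ax u v : dot (x u) v = dot u (x v).
    rewrite /x /= -[v in LHS]JK -[u in RHS]JK !(anti_dot antiJ).
    by rewrite (adjP bY) aY.
  have xy u : x (y u) = y (x u).
    by rewrite /x /y /= !JK (commutantE _ MY MB).
  have Ex : E (x Om) = 0.
    rewrite /E (commutantE _ M2 Mx) -xy (commutantE _ M1 Mx) /rdot ax.
    by rewrite subrr.
  rewrite -[E (A Om)]subr0 -Ex EB.
  have near : nrm (A Om - x Om) <= e.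
    by rewrite xOm -(anti_nrm antiJ) (antiB antiJ) JK ltW.
  apply: le_trans (ler_normB _ _) _; rewrite mulrDr; apply: lerD.
    apply: le_trans (rdot_abs _ _) _.
    rewrite [leRHS]mulrCA; apply: ler_wpM2l; first exact: nrm_ge0.
    apply: le_trans (hc _) _; rewrite mulrCA; apply: ler_wpM2l => //.
    apply: le_trans (h2 _) _; rewrite mulrC; apply: ler_wpM2r => //.
  apply: le_trans (rdot_abs _ _) _; rewrite mulrA.
  apply: ler_wpM2r; first exact: nrm_ge0.
  by apply: le_trans (h1 _) _; rewrite mulrC; apply: ler_wpM2r.
suff h : y \o A = A \o y by move=> x; have := congr1 (fun f => f x) h.
apply: (bounded_eq dM'); [exact: bounded_comp|exact: bounded_comp|].
move=> _ [y2 M2 <-] /=; apply/eqP; rewrite -subr_eq0; apply/eqP.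
apply: (norm_dense_ext dM') => _ [y1 M1 <-].
by rewrite rdotDr rdotNr key// subrr.
Qed.

Lemma conj_in_commutant B : M B -> commutant M (J \o B \o J).
Proof.
move=> MB; have b := vna_bounded vM MB.
have by_ : bounded_operator (J \o B \o J) by apply: anti_conj_bounded.
have ly := bounded_linear by_.
split=> // A MA.
have [C [E [MC ME aC aE [-> _]]]] := selfadjoint_parts vM MA.
apply/funext => x; rewrite !fctE.
rewrite -[LHS]/((J \o B \o J) (C x + 'i *: E x)) (linD ly) (linZ ly) /=.
by rewrite (conj_commutes MC aC MB) (conj_commutes ME aE MB).
Qed.

End TomitaCommutation.

(** * Symmetric operators on tuples of vectors *)

Section Tuples.
Variables (R : realType) (n : nat).
Implicit Types H K : hilbertType R.

Definition tdot H (v w : 'I_n -> H) : R := \sum_i rdot (v i) (w i).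

Lemma tdotC H (v w : 'I_n -> H) : tdot v w = tdot w v.
Proof. by apply: eq_bigr => i _; rewrite rdotC. Qed.

Lemma tdotBr H (v w u : 'I_n -> H) : tdot v (w - u) = tdot v w - tdot v u.
Proof. by rewrite -sumrB; apply: eq_bigr => i _; rewrite !fctE rdotDr rdotNr. Qed.

Lemma tdotBl H (v w u : 'I_n -> H) : tdot (w - u) v = tdot w v - tdot u v.
Proof. by rewrite !(tdotC _ v) tdotBr. Qed.

Lemma tdot_ge0 H (v : 'I_n -> H) : 0 <= tdot v v.
Proof. by apply: sumr_ge0 => i _; rewrite rdotxx sqr_ge0. Qed.

Lemma nrm_le_tdot H (v : 'I_n -> H) i : nrm (v i) ^+ 2 <= tdot v v.
Proof.
rewrite /tdot (bigD1 i)//= rdotxx lerDl.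
by apply: sumr_ge0 => j _; rewrite rdotxx sqr_ge0.
Qed.

Definition opmx H (X : 'I_n -> 'I_n -> H -> H) (v : 'I_n -> H) : 'I_n -> H :=
  fun i => \sum_j X i j (v j).

Lemma opmx_sym H (X : 'I_n -> 'I_n -> H -> H) :
  (forall i j, bounded_operator (X i j)) -> (forall i j, adj (X i j) = X j i) ->
  forall v w, tdot (opmx X v) w = tdot v (opmx X w).
Proof.
move=> bX aX v w; rewrite /tdot /opmx /rdot.
under eq_bigr => i _ do rewrite dot_suml raddf_sum.
under [RHS]eq_bigr => i _ do rewrite dot_sumr raddf_sum.
rewrite exchange_big; apply: eq_bigr => i _; apply: eq_bigr => j _.
by rewrite (adjP (bX j i)) aX.
Qed.

Lemma opmxB H (X : 'I_n -> 'I_n -> H -> H) v w :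
  (forall i j, linear (X i j)) -> opmx X (v - w) = opmx X v - opmx X w.
Proof.
move=> lX; apply/funext => i; rewrite !fctE /opmx -sumrB.
by apply: eq_bigr => j _; rewrite -(linB (lX i j)).
Qed.

(** The identity behind this is [T - T^2 = T (1 - T) T + (1 - T) T (1 - T)]. *)
Lemma symmetric_contraction H (T : ('I_n -> H) -> ('I_n -> H)) :
  (forall v w, tdot (T v) w = tdot v (T w)) ->
  (forall v w, T (v - w) = T v - T w) ->
  (forall v, 0 <= tdot v (T v) <= tdot v v) ->
  forall v, tdot (T v) (T v) <= tdot v v.
Proof.
move=> sT TB T01 v.
have /andP[h1 _] := T01 (v - T v); have /andP[_ h2] := T01 (T v).
have /andP[_ h3] := T01 v.
move: h1; rewrite TB !tdotBr !tdotBl -(sT v (T v)) => h1.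
lra.
Qed.

(** The sequence [<v, T^(2k) v>] is convex, so a bound on it, however bad, forces
    [|T v| <= |v|]. *)
Lemma power_bounded_contraction H (T : ('I_n -> H) -> ('I_n -> H)) v C :
  (forall v w, tdot (T v) w = tdot v (T w)) ->
  (forall k, tdot v (iter (k + k) T v) <= C) ->
  tdot (T v) (T v) <= tdot v v.
Proof.
move=> sT hC.
have sTk k w u : tdot (iter k T w) u = tdot w (iter k T u).
  by elim: k u => //= k IHk u; rewrite sT IHk -iterSr.
have := @convex_bounded_le _ (fun k => tdot v (iter (k + k) T v)) C.
rewrite /= -sT; apply=> // k.
have := tdot_ge0 (iter k T v - iter k.+2 T v).
rewrite !tdotBr !tdotBl !sTk -!iterD.
by rewrite !addSn !addnS; lra.
Qed.

End Tuples.

Lemma vna_sum (R : realType) (H : hilbertType R) (M : set (H -> H)) :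
  von_neumann_algebra M -> forall (I : finType) (f : I -> H -> H),
  (forall i, M (f i)) -> M (\sum_i f i).
Proof.
by move=> vM I f Mf; apply: (big_ind M) => //; [apply: vna0|apply: vnaD].
Qed.

(** * Complete positivity of homomorphisms *)

Section HomomorphismPositive.
Variables (R : realType) (H K : hilbertType R) (M : set (H -> H)).
Variables (pi : (H -> H) -> (K -> K)) (S : set K).
Hypotheses (vM : von_neumann_algebra M) (lpi : linear_on M pi) (pi1 : pi id = id).
Hypothesis piM : forall A B, M A -> M B -> pi (A \o B) = pi A \o pi B.
Hypothesis pi_adj : forall A, M A -> pi (adj A) = adj (pi A).
Hypothesis pib : forall A, M A -> bounded_operator (pi A).
Hypothesis dS : norm_dense S.
Hypothesis pi_le : forall v w, S v -> S w -> exists C : R,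
  forall A, M A -> (forall h, nrm (A h) <= nrm h) -> rdot v (pi A w) <= C.

Let pi0 : pi 0 = 0.
Proof.
by have := lpi (-1) (vna_id vM) (vna_id vM); rewrite !scaleN1r !addNr.
Qed.

Let piD A B : M A -> M B -> pi (A + B) = pi A + pi B.
Proof. by move=> MA MB; have := lpi 1 MA MB; rewrite !scale1r. Qed.

Let pi_sum (I : finType) (f : I -> H -> H) : (forall i, M (f i)) ->
  pi (\sum_i f i) = \sum_i pi (f i).
Proof.
move=> Mf.
have [] // : M (\sum_i f i) /\ pi (\sum_i f i) = \sum_i pi (f i).
apply: (big_ind2 (fun A B => M A /\ pi A = B)) => [|A B C D [MA <-] [MC <-]|i _].
- by split=> //; apply: vna0.
- by split; [apply: vnaD|rewrite piD].
- by split.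
Qed.

Section Matrix.
Variables (n : nat) (A : 'I_n -> 'I_n -> H -> H).
Hypothesis MA : forall i j, M (A i j).
Hypothesis posA : forall h : 'I_n -> H, 0 <= \sum_i \sum_j dot (h i) (A i j (h j)).

Let bA i j : bounded_operator (A i j). Proof. exact: vna_bounded (MA i j). Qed.

(** The form of a positive matrix is real, hence hermitian; evaluate it on tuples
    with one nonzero entry. *)
Lemma positive_entries_adj i j : adj (A i j) = A j i.
Proof.
pose F (h k : 'I_n -> H) := \sum_i \sum_j dot (h i) (A i j (k j)).
have FDl x y z : F (x + y) z = F x z + F y z.
  rewrite -big_split; apply: eq_bigr => p _; rewrite -big_split.
  by apply: eq_bigr => q _; rewrite dotDl.
have FDr x y z : F x (y + z) = F x y + F x z.
  rewrite -big_split; apply: eq_bigr => p _; rewrite -big_split.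
  by apply: eq_bigr => q _; rewrite (linD (bounded_linear (bA p q))) dotDr.
have FZl x y : F ('i *: x) y = - 'i * F x y.
  rewrite mulr_sumr; apply: eq_bigr => p _; rewrite mulr_sumr.
  by apply: eq_bigr => q _; rewrite dotZl conjCi.
have FZr x y : F x ('i *: y) = 'i * F x y.
  rewrite mulr_sumr; apply: eq_bigr => p _; rewrite mulr_sumr.
  by apply: eq_bigr => q _; rewrite (linZ (bounded_linear (bA p q))) dotZr.
have F0 x : complex.Im (F x x) = 0 by case/pos0P: (posA x).
have herm := hermitian_of_real FDl FDr FZl FZr F0.
pose d (i : 'I_n) (x : H) : 'I_n -> H := fun k => if k == i then x else 0.
have Fd p q x y : F (d p x) (d q y) = dot x (A p q y).
  rewrite /F (bigD1 p)//= (bigD1 q)//= /d !eqxx.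
  rewrite [X in _ + X + _]big1 ?addr0 => [|k /negPf ->]; last first.
    by rewrite (lin0 (bounded_linear (bA p k))) dot0r.
  rewrite big1 ?addr0// => k /negPf ->.
  by rewrite big1// => l _; rewrite dot0l.
apply: adj_eq => x y.
by rewrite dotC -(Fd i j y x) (herm (d j x) (d i y)) conjCK Fd.
Qed.

Lemma form_bounded : exists2 c : R, 0 < c &
  forall h : 'I_n -> H, tdot h (opmx A h) <= c * tdot h h.
Proof.
have /choice [c hc] : forall p : 'I_n * 'I_n, exists c : R, 0 <= c /\
    forall x, nrm (A p.1 p.2 x) <= c * nrm x.
  by move=> p; have [_ [c c0 h]] := boundedP (bA p.1 p.2); exists c.
exists (1 + \sum_i \sum_j c (i, j)).
  by rewrite ltr_wpDr// sumr_ge0// => i _; rewrite sumr_ge0// => j _; case: (hc (i, j)).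
move=> h; rewrite mulrDl mul1r -[leLHS]add0r lerD ?tdot_ge0//.
rewrite mulr_suml; apply: ler_sum => i _; rewrite mulr_suml.
rewrite /rdot dot_sumr raddf_sum; apply: ler_sum => j _.
have [c0 cx] := hc (i, j).
apply: le_trans (rdot_le _ _) _.
apply: (@le_trans _ _ (c (i, j) * (nrm (h i) * nrm (h j)))).
  by rewrite mulrCA ler_wpM2l ?nrm_ge0//; apply: cx.
rewrite ler_wpM2l//.
have := nrm_le_tdot h i; have := nrm_le_tdot h j.
have := sqr_ge0 (nrm (h i) - nrm (h j)).
by rewrite sqrrB; lra.
Qed.

(** For [c] large, [b = 1 - A/c] is a symmetric contraction, so the entries of its
    powers are contractions in [M] and the numbers [<v, pi(b)^(2k) v>] are
    bounded.  Hence [pi(b)] does not increase the norm of [v], which makes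
    [<v, pi(A) v> = c <v, (1 - pi(b)) v>] nonnegative. *)
Lemma pi_matrix_ge0_dense (v : 'I_n -> K) : (forall i, S (v i)) ->
  0 <= tdot v (opmx (fun i j => pi (A i j)) v).
Proof.
move=> Sv; have [c c0 hc] := form_bounded.
pose one i j : H -> H := if i == j :> 'I_n then id else 0.
pose b i j := (- c^-1)%:C%C *: A i j + one i j.
have Mone i j : M (one i j).
  by rewrite /one; case: eqP => _; [apply: vna_id|apply: vna0].
have Mb i j : M (b i j) by apply: vna_lin.
have onex (L : hilbertType R) (x : 'I_n -> L) i :
    \sum_j (if i == j then id else 0 : L -> L) (x j) = x i.
  rewrite (bigD1 i)//= eqxx big1 ?addr0// => j /negPf.
  by rewrite eq_sym => ->.
have opb h : opmx b h = h - (c^-1)%:C%C *: opmx A h.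
  apply/funext => i; rewrite !fctE /opmx scaler_sumr.
  rewrite -[X in _ = X - _](onex H h i) -sumrB; apply: eq_bigr => j _.
  by rewrite /b !fctE rmorphN scaleNr addrC.
have opb_pi w : opmx (fun i j => pi (b i j)) w =
    w - (c^-1)%:C%C *: opmx (fun i j => pi (A i j)) w.
  apply/funext => i; rewrite !fctE /opmx scaler_sumr.
  rewrite -[X in _ = X - _](onex K w i) -sumrB; apply: eq_bigr => j _.
  rewrite /b lpi// !fctE rmorphN scaleNr addrC; congr (_ - _).
  by rewrite /one; case: eqP => _; rewrite ?pi1 ?pi0.
have adjb i j : adj (b i j) = b j i.
  rewrite adj_lin//; last exact: vna_bounded (Mone i j).
  rewrite positive_entries_adj conj_Creal ?complex_real//; congr (_ + _).
  rewrite /one eq_sym; case: eqP => _; first exact: adj_id.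
  exact: adj0.
have symb := opmx_sym (fun i j => vna_bounded vM (Mb i j)) adjb.
have tZ (L : hilbertType R) (w u : 'I_n -> L) (r : R) :
    tdot w (r%:C%C *: u) = r * tdot w u.
  by rewrite /tdot mulr_sumr; apply: eq_bigr => i _; rewrite !fctE rdotZr.
have contr_b : forall h, tdot (opmx b h) (opmx b h) <= tdot h h.
  apply: symmetric_contraction => // [h k|h].
    by apply: opmxB => i j; apply: (vna_linear vM (Mb i j)).
  rewrite opb tdotBr tZ lerBlDr lerDl subr_ge0; apply/andP; split.
    by rewrite mulrC ler_pdivrMr// mulrC.
  rewrite mulr_ge0 ?invr_ge0 ?(ltW c0)//.
  have /pos0P [_] := posA h; rewrite raddf_sum /=; congr (_ <= _).
  by apply: eq_bigr => i _; rewrite /rdot dot_sumr.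
(* the entries of the powers of b have to be kept inside M, so that pi can be
   applied to them *)
pose bp := fix bp k i j : H -> H :=
  if k is k'.+1 then \sum_l (b i l \o bp k' l j) else one i j.
have Mbp k i j : M (bp k i j).
  elim: k i j => //= k IHk i j; apply: vna_sum => // l; exact: vna_comp.
have opbp k h : opmx (bp k) h = iter k (opmx b) h.
  elim: k => [|k IHk] /=; first by apply/funext => i; rewrite /opmx onex.
  rewrite -IHk; apply/funext => i; rewrite /opmx.
  under eq_bigr => j _ do rewrite fct_sumE.
  rewrite exchange_big; apply: eq_bigr => l _.
  by rewrite (lin_sum (vna_linear vM (Mb i l))).
pose T := opmx (fun i j => pi (b i j)).
have opT k w : opmx (fun i j => pi (bp k i j)) w = iter k T w.
  elim: k => [|k IHk] /=.
    apply/funext => i; rewrite /opmx -[RHS](onex K w i); apply: eq_bigr => j _.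
    by rewrite /one; case: eqP => _; rewrite ?pi1 ?pi0.
  rewrite -IHk; apply/funext => i; rewrite /T /opmx.
  have e j : pi (\sum_l (b i l \o bp k l j)) = \sum_l (pi (b i l) \o pi (bp k l j)).
    rewrite pi_sum; last by move=> l; apply: vna_comp.
    by apply: eq_bigr => l _; rewrite piM.
  under eq_bigr => j _ do rewrite e fct_sumE.
  rewrite exchange_big; apply: eq_bigr => l _.
  by rewrite (lin_sum (bounded_linear (pib (Mb i l)))).
have symT : forall w u, tdot (T w) u = tdot w (T u).
  by apply: opmx_sym => i j; [apply: pib|rewrite -pi_adj// adjb].
have iter_contr k h : tdot (iter k (opmx b) h) (iter k (opmx b) h) <= tdot h h.
  by elim: k => //= k IHk; apply: le_trans IHk.
have bp_contr k i j x : nrm (bp k i j x) <= nrm x.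
  pose d : 'I_n -> H := fun l => if l == j then x else 0.
  have dx : opmx (bp k) d i = bp k i j x.
    rewrite /opmx (bigD1 j)//= /d eqxx big1 ?addr0// => l /negPf ->.
    exact: (lin0 (vna_linear vM (Mbp k i l))).
  have dd : tdot d d = nrm x ^+ 2.
    rewrite /tdot (bigD1 j)//= /d eqxx rdotxx big1 ?addr0// => l /negPf ->.
    by rewrite rdot0l.
  rewrite -(@ler_pXn2r _ 2)// ?nnegrE ?nrm_ge0// -dx -dd opbp.
  by apply: le_trans (nrm_le_tdot _ i) _.
have /choice [C hC] : forall p : 'I_n * 'I_n, exists C : R, forall B, M B ->
    (forall h, nrm (B h) <= nrm h) -> rdot (v p.1) (pi B (v p.2)) <= C.
  by move=> p; apply: pi_le.
have bnd k : tdot v (iter (k + k) T v) <= \sum_i \sum_j C (i, j).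
  rewrite -opT; apply: ler_sum => i _; rewrite /rdot /opmx dot_sumr raddf_sum.
  by apply: ler_sum => j _; apply: (hC (i, j)) => // x; apply: bp_contr.
have Tv := power_bounded_contraction symT bnd.
have := tdot_ge0 (v - T v); rewrite !tdotBr !tdotBl (symT v v).
have : tdot v (T v) = tdot v v - c^-1 * tdot v (opmx (fun i j => pi (A i j)) v).
  by rewrite /T opb_pi tdotBr tZ.
move=> e1 e2.
have : 0 <= c^-1 * tdot v (opmx (fun i j => pi (A i j)) v) by lra.
by rewrite pmulr_rge0// invr_gt0.
Qed.

Lemma pi_matrix_pos (v : 'I_n -> K) : 
  0 <= \sum_i \sum_j dot (v i) (pi (A i j) (v j)).
Proof.
have adjp i j : adj (pi (A i j)) = pi (A j i).
  by rewrite -pi_adj// positive_entries_adj.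
apply/pos0P; split.
  apply: conj_eq_Im0; rewrite rmorph_sum exchange_big; apply: eq_bigr => i _.
  rewrite rmorph_sum; apply: eq_bigr => j _.
  by rewrite -adjp -(adjP (pib (MA i j))); apply: dotC.
have /choice [c hc] : forall p : 'I_n * 'I_n, exists c : R, 0 <= c /\
    forall x, nrm (pi (A p.1 p.2) x) <= c * nrm x.
  by move=> p; have [_ [c c0 h]] := boundedP (pib (MA p.1 p.2)); exists c.
pose k := \sum_i \sum_j c (i, j) * (nrm (v j) + nrm (v i) + 1).
have k0 : 0 <= k.
  rewrite sumr_ge0// => i _; rewrite sumr_ge0// => j _; case: (hc (i, j)) => c0 _.
  by rewrite mulr_ge0// !addr_ge0// nrm_ge0.
rewrite -oppr_le0; apply: (@le_of_eps _ _ _ k) => // e0 e00; rewrite add0r.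
pose e := Num.min e0 1.
have e1 : 0 < e by rewrite lt_min e00 ltr01.
have ele : e <= 1 by rewrite ge_min lexx orbT.
have ele0 : e <= e0 by rewrite ge_min lexx.
apply: (@le_trans _ _ (e * k)); last by rewrite ler_wpM2r.
have /choice [w hw] : forall i, exists s, S s /\ nrm (v i - s) < e.
  by move=> i; have [s Ss hs] := dS (v i) e1; exists s.
have := pi_matrix_ge0_dense (fun i => proj1 (hw i)) => h0.
have reE (u : 'I_n -> K) : complex.Re (\sum_i \sum_j dot (u i) (pi (A i j) (u j))) =
    \sum_i \sum_j rdot (u i) (pi (A i j) (u j)).
  by rewrite raddf_sum; apply: eq_bigr => i _; rewrite raddf_sum.
have {}h0 : 0 <= \sum_i \sum_j rdot (w i) (pi (A i j) (w j)).
  apply: le_trans h0 _; rewrite le_eqVlt; apply/orP; left; apply/eqP.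
  apply: eq_bigr => i _; rewrite /opmx /rdot dot_sumr raddf_sum.
  by apply: eq_bigr => j _.
suff : \sum_i \sum_j rdot (w i) (pi (A i j) (w j)) -
    \sum_i \sum_j rdot (v i) (pi (A i j) (v j)) <= e * k by rewrite reE; lra.
rewrite -sumrB mulr_sumr; apply: ler_sum => i _.
rewrite -sumrB mulr_sumr; apply: ler_sum => j _.
have [c0 /= cx] := hc (i, j).
have lp := bounded_linear (pib (MA i j)).
have [_ hi] := hw i; have [_ hj] := hw j.
have -> : rdot (w i) (pi (A i j) (w j)) - rdot (v i) (pi (A i j) (v j)) =
    rdot (w i - v i) (pi (A i j) (v j)) + rdot (w i) (pi (A i j) (w j - v j)).
  by rewrite (linB lp) !rdotE; ring.
have nw : nrm (w i) <= nrm (v i) + 1.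
  have := nrmD (v i) (w i - v i); rewrite addrC subrK nrmB.
  by have := nrm_ge0 (v i); lra.
have r1 : rdot (w i - v i) (pi (A i j) (v j)) <= e * (c (i, j) * nrm (v j)).
  apply: le_trans (rdot_le _ _) _; apply: ler_pM; rewrite ?nrm_ge0//.
  by rewrite nrmB ltW.
have r2 : rdot (w i) (pi (A i j) (w j - v j)) <= (nrm (v i) + 1) * (c (i, j) * e).
  apply: le_trans (rdot_le _ _) _; apply: ler_pM; rewrite ?nrm_ge0//.
  by apply: le_trans (cx _) _; rewrite ler_wpM2l// nrmB ltW.
apply: le_trans (lerD r1 r2) _.
by rewrite le_eqVlt; apply/orP; left; apply/eqP; ring.
Qed.
End Matrix.

(** The hypothesis [pi_le] asks for some bound on each matrix coefficient; the
    constants disappear on passing to powers. *)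
Lemma hom_completely_positive : completely_positive M pi.
Proof.
move=> n A MA posA v; have := pi_matrix_pos MA posA v.
by congr (_ <= _); apply: eq_bigr => i _; apply: eq_bigr => j _; rewrite mxE.
Qed.

End HomomorphismPositive.

Lemma completely_positive_pos (R : realType) (H K : hilbertType R)
    (M : set (H -> H)) (Phi : (H -> H) -> (K -> K)) A :
  completely_positive M Phi -> M A -> op_pos A -> op_pos (Phi A).
Proof.
move=> cp MA pA x.
have := cp 1%N (const_mx A) _ _ (fun=> x).
rewrite !big_ord1 !mxE; apply=> [i j|h]; first by rewrite mxE.
by rewrite !big_ord1 mxE.
Qed.

(** * Homomorphisms with an intertwining isometry *)

Section Dilation.
Variables (R : realType) (H L : hilbertType R).
Variables (M : set (H -> H)) (Om : H) (N : set (L -> L)) (Om' : L).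
Variables (pi : (H -> H) -> (L -> L)) (W : H -> L).
Hypotheses (vM : von_neumann_algebra M) (vN : von_neumann_algebra N).
Hypotheses (sepM : separating M Om) (sepN : separating N Om').
Hypotheses (bW : bounded_operator W) (WK : forall x, adj W (W x) = x).
Hypothesis WOm : W Om = Om'.
Hypothesis WNW : forall T, N T -> M (adj W \o T \o W).

Definition compression (T : L -> L) : H -> H := adj W \o T \o W.

Lemma compression_stochastic :
  stochastic N (vector_state Om') M (vector_state Om) compression.
Proof.
have linE : linear_on N compression.
  move=> a A B NA NB; apply/funext => x; rewrite /compression /= !fctE.
  exact: (bounded_linear (bounded_adj bW)).
have cpE : completely_positive N compression.
  move=> n A NA posA v; have := posA (W \o v).
  congr (_ <= _); apply: eq_bigr => i _; apply: eq_bigr => j _.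
  by rewrite mxE /compression /= (adjP bW).
have stE A : N A -> vector_state Om (compression A) = vector_state Om' A.
  by move=> NA; rewrite /vector_state /compression /= -(adjP bW) WOm.
split=> //; first by split=> //; apply/funext => x; apply: WK.
apply: (normal_of_state (Om := Om') vN vM sepM) => // A NA.
  exact: (completely_positive_pos cpE NA).
have bA := vna_bounded vN NA.
symmetry; apply: adj_eq => x y.
by rewrite /compression /= (adjPr bW) (adjP bA) (adjP bW).
Qed.

(** The compression of [adj T \o T] kills the separating vector [Om], so it
    vanishes, and its diagonal coefficients are the squares [|T (W x)|^2]. *)
Lemma annihilates_range T x : N T -> T Om' = 0 -> T (W x) = 0.
Proof.
move=> NT TOm; have bT := vna_bounded vN NT.
have E0 : adj W \o (adj T \o T) \o W = 0.
  apply: sepM; first by apply: WNW; apply: (vna_comp vN) => //; apply: (vna_adj vN).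
  rewrite /= WOm TOm (lin0 (bounded_linear (bounded_adj bT))).
  exact: (lin0 (bounded_linear (bounded_adj bW))).
have := congr1 (fun f => dot x (f x)) E0.
rewrite /= -(adjP bW) -(adjP bT) => h0; apply: dot_self_eq0.
by rewrite h0; apply: dot0r.
Qed.

Variable S : set L.
Hypotheses (lpi : linear_on M pi) (pi1 : pi id = id).
Hypothesis piN : forall A, M A -> N (pi A).
Hypothesis piM : forall A B, M A -> M B -> pi (A \o B) = pi A \o pi B.
Hypothesis pi_adj : forall A, M A -> pi (adj A) = adj (pi A).
Hypothesis dS : norm_dense S.
Hypothesis pi_le : forall v w, S v -> S w -> exists C : R,
  forall A, M A -> (forall h, nrm (A h) <= nrm h) -> rdot v (pi A w) <= C.
Hypothesis piOm : forall A, M A -> pi A Om' = W (A Om).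

Lemma dilation_stochastic :
  stochastic M (vector_state Om) N (vector_state Om') pi.
Proof.
have st A : M A -> vector_state Om' (pi A) = vector_state Om A.
  by move=> MA; rewrite /vector_state piOm// -WOm (adjP bW) WK.
have cp : completely_positive M pi.
  apply: (hom_completely_positive vM lpi pi1 piM pi_adj _ dS pi_le) => A MA.
  exact: vna_bounded (piN MA).
split=> //; apply: (normal_of_state (Om := Om) vM vN sepN) => // A MA.
exact: (completely_positive_pos cp MA).
Qed.

Lemma dilation_adjoint :
  markov_adjoint M (vector_state Om) N (vector_state Om') pi compression.
Proof.
split; first exact: compression_stochastic.
move=> A B MA NB; rewrite /vector_state /compression /= piOm//.
by rewrite -(adjP bW) WOm.
Qed.

Lemma dilation_preserving_markov :
  preserving_markov M (vector_state Om) N (vector_state Om') pi /\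
  deterministic M pi.
Proof.
split; last by split.
by split; [exact: dilation_stochastic|exists compression; apply: dilation_adjoint].
Qed.

End Dilation.

(** * The Stinespring representations *)

Section Stinespring.
Variables (R : realType) (H1 H2 : hilbertType R).
Variables (M1 : set (H1 -> H1)) (Om1 : H1) (M2 : set (H2 -> H2)) (Om2 : H2).
Hypotheses (vM1 : von_neumann_algebra M1) (vM2 : von_neumann_algebra M2).
Variables (Psi : (H2 -> H2) -> (H1 -> H1)).
Hypothesis stoPsi :
  stochastic M2 (vector_state Om2) M1 (vector_state Om1) Psi.
Variables (L : hilbertType R) (S : stinespring M1 Om1 M2 Om2 Psi L).

Let tens := st_tens S.
Let V := st_V S.
Let vM1' := vna_commutant vM1.

Let PsiM A : M2 A -> M1 (Psi A). Proof. by case: stoPsi => h _ _ _ _; apply: h. Qed.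
Let Psi1 : Psi id = id. Proof. by case: stoPsi => _ []. Qed.

Definition tensor_sums : set L :=
  [set v | exists n (A : 'I_n -> H2 -> H2) (h : 'I_n -> H1),
    (forall i, M2 (A i)) /\ v = \sum_i st_tens S (A i) (h i)].

Lemma tensor_sums_dense : norm_dense tensor_sums.
Proof. by apply/denseP; apply: st_tens_dense. Qed.

Lemma tensor_ext u v :
  (forall X h, M2 X -> dot (tens X h) u = dot (tens X h) v) -> u = v.
Proof.
move=> h; apply/eqP; rewrite -subr_eq0; apply/eqP.
apply: (norm_dense_ext tensor_sums_dense) => _ [n [A [k [MA ->]]]].
rewrite /rdot dot_suml big1// => i _.
by rewrite dotBr -[st_tens S]/tens h// subrr.
Qed.

Lemma tensor_bounded_eq (f g : L -> L) : bounded_operator f ->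
  bounded_operator g -> (forall X h, M2 X -> f (tens X h) = g (tens X h)) ->
  f = g.
Proof.
move=> bf bg h; apply: (bounded_eq tensor_sums_dense) => // _ [n [A [k [MA ->]]]].
rewrite (lin_sum (bounded_linear bf)) (lin_sum (bounded_linear bg)).
by apply: eq_bigr => i _; apply: h.
Qed.

(** The squared norm of [X (x) h] is [<h, Psi(adj X \o X) h>]. *)
Lemma tensor_bounded X : M2 X -> bounded_operator (tens X).
Proof.
move=> MX.
have MXX : M2 (adj X \o X) by apply: vna_comp => //; apply: vna_adj.
have [_ [c c0 hc]] := boundedP (vna_bounded vM1 (PsiM MXX)).
apply: (@boundedI _ _ _ _ (c + 1)); first exact: st_tens_linearr.
move=> h; rewrite -(@ler_pXn2r _ 2)// ?nnegrE ?mulr_ge0 ?nrm_ge0 ?addr_ge0//.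
rewrite -rdotxx /rdot st_tens_dot// -/(rdot _ _).
apply: le_trans (rdot_le _ _) _.
apply: (@le_trans _ _ (c * nrm h ^+ 2)).
  by rewrite expr2 mulrCA ler_wpM2l ?nrm_ge0.
rewrite exprMn ler_wpM2r ?sqr_ge0// sqrrD expr1n mulr1.
by have := sqr_ge0 c; lra.
Qed.

Lemma stV_dot h k : dot (V h) (V k) = dot h k.
Proof.
rewrite /V /st_V st_tens_dot; [|exact: vna_id|exact: vna_id].
rewrite adj_id; have -> : (id \o id : H2 -> H2) = id by [].
by rewrite Psi1.
Qed.

Lemma stV_bounded : bounded_operator V.
Proof. by apply: tensor_bounded; apply: vna_id. Qed.

Lemma stV_isometry h : adj V (V h) = h.
Proof. by apply: dot_ext => k; rewrite -(adjP stV_bounded) stV_dot. Qed.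

Section Sigma.
Let sigma := st_sigma S.

Lemma sigma_lin (a : R[i]) A B : M2 A -> M2 B ->
  sigma (a *: A + B) = a *: sigma A + sigma B.
Proof.
move=> MA MB; have MAB := vna_lin vM2 a MA MB.
apply: tensor_bounded_eq => [||X h MX].
- exact: st_sigma_bounded.
- by apply: bounded_lin; apply: st_sigma_bounded.
- rewrite !fctE /sigma !st_sigmaE//.
  have -> : (a *: A + B) \o X = a *: (A \o X) + (B \o X) by [].
  by apply: (st_tens_linearl S); apply: vna_comp.
Qed.

Lemma sigma_id : sigma id = id.
Proof.
apply: tensor_bounded_eq => [||X h MX].
- by apply: st_sigma_bounded; apply: vna_id.
- exact: bounded_id.
- by rewrite /sigma st_sigmaE//; apply: vna_id.
Qed.

Lemma sigmaM A B : M2 A -> M2 B -> sigma (A \o B) = sigma A \o sigma B.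
Proof.
move=> MA MB; have MAB := vna_comp vM2 MA MB.
apply: tensor_bounded_eq => [||X h MX].
- exact: st_sigma_bounded.
- by apply: bounded_comp; apply: st_sigma_bounded.
- by rewrite /sigma /= !st_sigmaE//; apply: vna_comp.
Qed.

Lemma sigma_adj A : M2 A -> sigma (adj A) = adj (sigma A).
Proof.
move=> MA; have MA' := vna_adj vM2 MA.
have bs := st_sigma_bounded S MA.
apply: tensor_bounded_eq => [||X h MX].
- exact: st_sigma_bounded.
- exact: bounded_adj.
- apply: tensor_ext => Y k MY; rewrite -(adjP bs) /sigma !st_sigmaE//.
  rewrite !st_tens_dot//; try exact: vna_comp.
  by rewrite adj_comp//; apply: vna_bounded; eassumption.
Qed.

(** Complete positivity of [Psi] on the matrix [adj (Y i) (1 - adj A A) (Y j)],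
    which is positive when [A] is a contraction. *)
Lemma sigma_contraction A w : M2 A -> (forall h, nrm (A h) <= nrm h) ->
  tensor_sums w -> nrm (sigma A w) <= nrm w.
Proof.
move=> MA cA [n [Y [k [MY ->]]]].
have bs := st_sigma_bounded S MA.
rewrite -(@ler_pXn2r _ 2)// ?nnegrE ?nrm_ge0//.
rewrite /sigma -[leRHS]rdotxx (lin_sum (bounded_linear bs)) -rdotxx.
have bY i := vna_bounded vM2 (MY i); have bA := vna_bounded vM2 MA.
have MAY i : M2 (A \o Y i) by apply: vna_comp.
pose P i j := adj (Y i) \o Y j; pose Q i j := adj (A \o Y i) \o (A \o Y j).
have MP i j : M2 (P i j) by apply: vna_comp => //; apply: vna_adj.
have MQ i j : M2 (Q i j) by apply: vna_comp => //; apply: vna_adj.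
have [_ [lPsi _] cp _ _] := stoPsi.
have := cp n (\matrix_(i, j) (P i j - Q i j)) _ _ k.
have PsiB i j : Psi (P i j - Q i j) = Psi (P i j) - Psi (Q i j).
  by rewrite addrC -scaleN1r lPsi// scaleN1r addrC.
have sumE (Z : 'I_n -> H2 -> H2) : (forall i, M2 (Z i)) ->
    rdot (\sum_i tens (Z i) (k i)) (\sum_i tens (Z i) (k i)) =
    complex.Re (\sum_i \sum_j dot (k i) (Psi (adj (Z i) \o Z j) (k j))).
  move=> MZ; rewrite /rdot dot_suml; congr complex.Re; apply: eq_bigr => i _.
  by rewrite dot_sumr; apply: eq_bigr => j _; rewrite /tens st_tens_dot.
move=> h.
have {}h : 0 <= \sum_i \sum_j dot (k i) (Psi (P i j) (k j)) -
    \sum_i \sum_j dot (k i) (Psi (Q i j) (k j)).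
  rewrite -sumrB; under eq_bigr => i _ do rewrite -sumrB.
  have -> : \sum_i \sum_j (dot (k i) (Psi (P i j) (k j)) -
        dot (k i) (Psi (Q i j) (k j))) = \sum_i \sum_j dot (k i)
      (map_mx Psi (\matrix_(i, j) (P i j - Q i j)) i j (k j)).
    apply: eq_bigr => i _; apply: eq_bigr => j _.
    by rewrite !mxE PsiB !fctE dotBr.
  apply: h => [i j|x]; first by rewrite mxE; apply: vnaB.
  pose z := \sum_i Y i (x i).
  have lA := bounded_linear bA.
  have -> : \sum_i \sum_j dot (x i) ((\matrix_(i, j) (P i j - Q i j)) i j (x j)) =
      dot z z - dot (A z) (A z).
    rewrite /z (lin_sum lA) !dot_suml -sumrB; apply: eq_bigr => i _.
    rewrite !dot_sumr -sumrB; apply: eq_bigr => j _.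
    rewrite mxE /P /Q !fctE dotBr (adjP (bY i)); congr (_ - _).
    by rewrite -(adjP (bounded_comp bA (bY i))).
  rewrite !dot_nrm -rmorphB ler0c subr_ge0.
  by rewrite ler_pXn2r ?nnegrE ?nrm_ge0.
move: h => /pos0P [_]; rewrite raddfB /= subr_ge0 => h.
rewrite [leRHS]sumE//; apply: le_trans h; rewrite -(sumE _ MAY).
rewrite le_eqVlt; apply/orP; left; apply/eqP; congr rdot;
  by apply: eq_bigr => i _; rewrite /tens st_sigmaE.
Qed.

Lemma sigma_le v w : tensor_sums v -> tensor_sums w -> exists C : R,
  forall A, M2 A -> (forall h, nrm (A h) <= nrm h) -> rdot v (sigma A w) <= C.
Proof.
move=> Sv Sw; exists (nrm v * nrm w) => A MA cA.
apply: le_trans (rdot_le _ _) _; rewrite ler_wpM2l ?nrm_ge0//.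
exact: sigma_contraction.
Qed.

End Sigma.

Section Tau.
Let tau := st_tau S.

Lemma tau_lin (a : R[i]) A B : commutant M1 A -> commutant M1 B ->
  tau (a *: A + B) = a *: tau A + tau B.
Proof.
move=> MA MB; have MAB := vna_lin vM1' a MA MB.
apply: tensor_bounded_eq => [||X h MX].
- exact: st_tau_bounded.
- by apply: bounded_lin; apply: st_tau_bounded.
- by rewrite !fctE /tau !st_tauE// /= (st_tens_linearr S MX).
Qed.

Lemma tau_id : tau id = id.
Proof.
apply: tensor_bounded_eq => [||X h MX].
- by apply: st_tau_bounded; apply: (vna_id vM1').
- exact: bounded_id.
- by rewrite /tau st_tauE//; apply: (vna_id vM1').
Qed.

Lemma tauM A B : commutant M1 A -> commutant M1 B ->
  tau (A \o B) = tau A \o tau B.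
Proof.
move=> MA MB; have MAB := vna_comp vM1' MA MB.
apply: tensor_bounded_eq => [||X h MX].
- exact: st_tau_bounded.
- by apply: bounded_comp; apply: st_tau_bounded.
- by rewrite /tau /= !st_tauE.
Qed.

Lemma tau_adj A : commutant M1 A -> tau (adj A) = adj (tau A).
Proof.
move=> MA; have MA' := vna_adj vM1' MA.
have bs := st_tau_bounded S MA.
apply: tensor_bounded_eq => [||X h MX].
- exact: st_tau_bounded.
- exact: bounded_adj.
- apply: tensor_ext => Y k MY; rewrite -(adjP bs) /tau !st_tauE//.
  rewrite !st_tens_dot// (adjP (proj1 MA)).
  have MP : M1 (Psi (adj Y \o X)).
    by apply: PsiM; apply: vna_comp => //; apply: vna_adj.
  by rewrite (commutantE _ MA' MP).
Qed.

Lemma tau_le v w : tensor_sums v -> tensor_sums w -> exists C : R,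
  forall A, commutant M1 A -> (forall h, nrm (A h) <= nrm h) ->
    rdot v (tau A w) <= C.
Proof.
move=> [n [X [h [MX ->]]]] [m [Y [k [MY ->]]]].
exists (\sum_i \sum_j nrm (adj (Psi (adj (X i) \o Y j)) (h i)) * nrm (k j)).
move=> A MA cA.
rewrite /tau (lin_sum (bounded_linear (st_tau_bounded S MA))) /rdot dot_suml raddf_sum.
apply: ler_sum => i _; rewrite dot_sumr raddf_sum; apply: ler_sum => j _.
have MP : M1 (Psi (adj (X i) \o Y j)).
  by apply: PsiM; apply: vna_comp => //; apply: vna_adj.
rewrite st_tauE// st_tens_dot// -(adjPr (vna_bounded vM1 MP)) -/(rdot _ _).
by apply: le_trans (rdot_le _ _) _; rewrite ler_wpM2l ?nrm_ge0.
Qed.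

End Tau.
End Stinespring.

(** * Standardness and factorization *)

Section Factorization.
Variables (R : realType) (H1 H2 : hilbertType R).
Variables (M1 : set (H1 -> H1)) (Om1 : H1) (M2 : set (H2 -> H2)) (Om2 : H2).
Hypotheses (std1 : standard_form M1 Om1) (std2 : standard_form M2 Om2).
Variables (J1 : H1 -> H1) (modJ1 : modular_conjugation M1 Om1 J1).
Variables (Phi : (H1 -> H1) -> (H2 -> H2)) (Phis : (H2 -> H2) -> (H1 -> H1)).
Hypotheses (stoPhi : stochastic M1 (vector_state Om1) M2 (vector_state Om2) Phi)
  (adjPhi :
    markov_adjoint M1 (vector_state Om1) M2 (vector_state Om2) Phi Phis).
Variables (L : hilbertType R) (S : stinespring M1 Om1 M2 Om2 Phis L).
Variable Jh : L -> L.
Hypotheses (antiJh : antiunitary Jh) (JhV : Jh \o st_V S = st_V S \o J1).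
Hypotheses
  (VRV : forall T, st_algebra S Jh T -> M1 (adj (st_V S) \o T \o st_V S))
  (LRL : forall T, st_algebra S Jh T ->
     M2 (adj (st_Lambda S) \o T \o st_Lambda S)).

Let vM1 : von_neumann_algebra M1. Proof. by case: std1. Qed.
Let vM2 : von_neumann_algebra M2. Proof. by case: std2. Qed.
Let sep1 : separating M1 Om1. Proof. by case: std1. Qed.
Let sep2 : separating M2 Om2. Proof. by case: std2. Qed.
Let stoPhis : stochastic M2 (vector_state Om2) M1 (vector_state Om1) Phis.
Proof. by case: adjPhi. Qed.

Let V := st_V S.
Let Lam := st_Lambda S.
Let Om := st_Omega S.
Let RR := st_algebra S Jh.
Let Ji := antiadj Jh.

Let antiJ1 : antiunitary J1. Proof. by case: modJ1. Qed.
Let bV : bounded_operator V. Proof. exact: (stV_bounded vM1 vM2 stoPhis S). Qed.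
Let bLam : bounded_operator Lam. Proof. exact: st_Lambda_bounded. Qed.

Let J1K x : J1 (J1 x) = x.
Proof. by have [_ [D [pD tD]]] := modJ1; apply: (conjugationK vM1 modJ1 pD tD). Qed.
Let J1Om : J1 Om1 = Om1.
Proof. by have [_ [D [pD tD]]] := modJ1; apply: (conjugation_Om vM1 modJ1 pD tD). Qed.
Let J1real A B : M1 A -> M1 B -> adj A = A -> adj B = B ->
  rdot (A Om1) ('i *: J1 (B Om1)) = 0.
Proof. by have [_ [D [pD tD]]] := modJ1; apply: (conjugation_real vM1 modJ1 pD tD). Qed.

Lemma sum_generators_bounded T :
  ([set st_sigma S A | A in M2] `|`
     [set antiadj Jh \o st_tau S Y \o Jh | Y in commutant M1]) T ->
  bounded_operator T.
Proof.
case=> -[A MA <-]; first exact: st_sigma_bounded.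
apply: anti_conj_bounded => //; first exact: antiunitary_antiadj.
exact: st_tau_bounded.
Qed.

Lemma st_algebra_vna : von_neumann_algebra RR.
Proof. by apply: vna_generated_vna; apply: sum_generators_bounded. Qed.

Lemma st_algebra_sigma A : M2 A -> RR (st_sigma S A).
Proof. by move=> MA; apply: sub_vna_generated; left; exists A. Qed.

Lemma st_algebra_tau Y : commutant M1 Y -> RR (Ji \o st_tau S Y \o Jh).
Proof. by move=> MY; apply: sub_vna_generated; right; exists Y. Qed.

Lemma JhVE x : Jh (V x) = V (J1 x).
Proof. exact: (congr1 (fun f => f x) JhV). Qed.

Lemma JiVE x : Ji (V x) = V (J1 x).
Proof. by rewrite -[in LHS](J1K x) -JhVE /Ji antiadjK. Qed.

Lemma tau_V Y x : commutant M1 Y ->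
  Ji (st_tau S Y (Jh (V x))) = V (J1 (Y (J1 x))).
Proof.
by move=> MY; rewrite JhVE st_tauE// ?JiVE//; apply: vna_id.
Qed.

(** One half of Tomita's theorem, read off the hypothesis on [V]. *)
Lemma conj_commutant_in Y : commutant M1 Y -> M1 (J1 \o Y \o J1).
Proof.
move=> MY; have := VRV (st_algebra_tau MY); congr M1; apply/funext => x.
by rewrite /= tau_V//; apply: (stV_isometry vM1 vM2 stoPhis S).
Qed.

Lemma conj_in_commutant1 A : M1 A -> commutant M1 (J1 \o A \o J1).
Proof.
exact: (conj_in_commutant vM1 sep1 antiJ1 J1K J1Om J1real conj_commutant_in).
Qed.

(** Here [Ji] is the inverse of [Jh]. *)
Definition second_leg (A : H1 -> H1) : L -> L :=
  Ji \o st_tau S (J1 \o A \o J1) \o Jh.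

Lemma second_leg_in A : M1 A -> RR (second_leg A).
Proof. by move=> MA; apply: st_algebra_tau; apply: conj_in_commutant1. Qed.

Lemma second_leg_V A x : M1 A -> second_leg A (V x) = V (A x).
Proof.
move=> MA; rewrite /second_leg.
by have := tau_V x (conj_in_commutant1 MA); rewrite /= !J1K.
Qed.

Lemma Lam_Om : Lam Om2 = Om.
Proof. exact: (st_LambdaE S (vna_id vM2)). Qed.

Lemma separating_Om : separating RR Om.
Proof.
move=> T RT TOm.
have bT := vna_bounded st_algebra_vna RT.
apply: (tensor_bounded_eq (S := S) bT (bounded0 L L)) => X h MX.
have RTX : RR (T \o st_sigma S X).
  by apply: (vna_comp st_algebra_vna) => //; apply: st_algebra_sigma.
have sV k : st_sigma S X (V k) = st_tens S X k.
  by rewrite /V /st_V st_sigmaE//; apply: vna_id.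
rewrite -sV.
apply: (annihilates_range st_algebra_vna sep1 bV erefl VRV h RTX).
rewrite /= sV -(st_LambdaE S MX).
exact: (annihilates_range st_algebra_vna sep2 bLam Lam_Om LRL _ RT TOm).
Qed.

Lemma cyclic_Om : cyclic RR Om.
Proof.
apply/denseP.
apply: dense_of_orthogonal => [|x hx].
  split; first by exists 0; [apply: (vna0 st_algebra_vna)|].
  move=> r _ _ [A RA <-] [B RB <-]; exists (r%:C%C *: A + B) => //.
  exact: (vna_lin st_algebra_vna).
apply: (tensor_ext (S := S)) => X h MX; rewrite dot0r.
have bX := tensor_bounded vM1 vM2 stoPhis S MX.
have dM1 : norm_dense [set A Om1 | A in M1] by case: std1 => _ /denseP.
rewrite (adjP bX); suff -> : adj (st_tens S X) x = 0 by rewrite dot0r.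
apply: (norm_dense_ext dM1) => _ [A MA <-].
rewrite /rdot -(adjP bX) -/(rdot _ _) rdotC; apply: hx.
exists (st_sigma S X \o second_leg A).
  by apply: (vna_comp st_algebra_vna); [apply: st_algebra_sigma|apply: second_leg_in].
rewrite /= -[Om]/(V Om1) second_leg_V// /V /st_V st_sigmaE//.
exact: vna_id.
Qed.

Lemma nrm_Om : `|Om| = 1.
Proof.
have := stV_dot vM2 stoPhis S Om1 Om1; rewrite !dotxx.
have [_ _ _ ->] := std1; rewrite expr1n => /eqP.
by rewrite sqrf_eq1 => /orP[/eqP //|/eqP h]; have := normr_ge0 (V Om1);
  rewrite h oppr_ge0 ler10.
Qed.

Lemma standard_Om : standard_form RR Om.
Proof.
split; [exact: st_algebra_vna|exact: cyclic_Om|exact: separating_Om|exact: nrm_Om].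
Qed.

Lemma dense2 : norm_dense [set B Om2 | B in M2].
Proof. by case: std2 => _ /denseP. Qed.

Lemma dot_Lam_V A B : M2 B -> M1 A ->
  dot (Lam (B Om2)) (V (A Om1)) = dot (B Om2) (Phi A Om2).
Proof.
move=> MB MA; have MB' := vna_adj vM2 MB.
have bB := vna_bounded vM2 MB.
rewrite /Lam st_LambdaE// /V /st_V st_tens_dot//; last exact: vna_id.
by have [_ /(_ A _ MA MB')] := adjPhi; rewrite /vector_state /= (adjP bB) => ->.
Qed.

(** The compression of the identity by [Lam] belongs to [M2] and fixes the
    separating vector [Om2]. *)
Lemma Lam_isometry x : adj Lam (Lam x) = x.
Proof.
have Rid : RR id := vna_id st_algebra_vna.
have h : (adj Lam \o id \o Lam) - id = 0.
  apply: sep2; first by apply: vnaB => //; [exact: LRL|exact: vna_id].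
  apply: (norm_dense_ext dense2) => _ [B MB <-].
  rewrite !fctE /rdot dotBr -(adjP bLam) Lam_Om.
  have := dot_Lam_V MB (vna_id vM1); rewrite /= -[V Om1]/Om => ->.
  by have [_ [_ ->] _ _ _] := stoPhi; rewrite subrr.
by apply/eqP; rewrite -subr_eq0; apply/eqP/(congr1 (fun f => f x) h).
Qed.

Lemma first_leg_markov :
  [/\ preserving_markov M2 (vector_state Om2) RR (vector_state Om) (st_sigma S),
    deterministic M2 (st_sigma S) &
    markov_adjoint M2 (vector_state Om2) RR (vector_state Om) (st_sigma S)
      (compression Lam)].
Proof.
have sOm A : M2 A -> st_sigma S A Om = Lam (A Om2).
  move=> MA; rewrite /Lam st_LambdaE// /Om /st_Omega st_sigmaE//; exact: vna_id.
have [h1 h2] := dilation_preserving_markov vM2 st_algebra_vna sep2 separating_Om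
  bLam Lam_isometry Lam_Om LRL (sigma_lin vM2 S) (sigma_id vM2 S)
  st_algebra_sigma (sigmaM vM2 S) (sigma_adj vM2 S) (tensor_sums_dense S)
  (fun v w hv hw => sigma_le vM2 stoPhis hv hw) sOm.
split=> //.
exact: (dilation_adjoint vM2 st_algebra_vna sep2 bLam Lam_isometry Lam_Om LRL sOm).
Qed.

(** The conjugations by [J1] and [Jh] are both anti-linear, so [second_leg] is
    linear.  Its matrix coefficients are bounded on the dense set of the vectors
    [Ji s], with [s] a finite sum of tensors. *)
Lemma second_leg_markov :
  preserving_markov M1 (vector_state Om1) RR (vector_state Om) second_leg /\
  deterministic M1 second_leg.
Proof.
have antiJi : antiunitary Ji by apply: antiunitary_antiadj.
have JA A : M1 A -> commutant M1 (J1 \o A \o J1) by apply: conj_in_commutant1.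
have lin_leg : linear_on M1 second_leg.
  move=> a A B MA MB; apply/funext => x; rewrite /second_leg.
  have -> : J1 \o (a *: A + B) \o J1 = a^* *: (J1 \o A \o J1) + (J1 \o B \o J1).
    by apply/funext => y; rewrite !fctE (antiP antiJ1).
  rewrite (tau_lin vM1 S _ (JA _ MA) (JA _ MB)) !fctE.
  by rewrite (antiP antiJi) conjCK.
have id_leg : second_leg id = id.
  rewrite /second_leg; have -> : J1 \o id \o J1 = id by apply/funext.
  by rewrite (tau_id vM1 S); apply/funext => x; apply: antiadjK.
have M_leg A B : M1 A -> M1 B -> second_leg (A \o B) = second_leg A \o second_leg B.
  move=> MA MB; rewrite /second_leg.
  have -> : J1 \o (A \o B) \o J1 = (J1 \o A \o J1) \o (J1 \o B \o J1).
    by apply/funext => y /=; rewrite J1K.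
  rewrite (tauM vM1 S (JA _ MA) (JA _ MB)).
  by apply/funext => x /=; rewrite /Ji antiadjKr.
have adj_leg A : M1 A -> second_leg (adj A) = adj (second_leg A).
  move=> MA; have bA := vna_bounded vM1 MA.
  have e : J1 \o adj A \o J1 = adj (J1 \o A \o J1).
    symmetry; apply: adj_eq => x y /=.
    rewrite -[y in LHS]J1K -[x in RHS]J1K !(anti_dot antiJ1).
    by rewrite (adjPr bA).
  have bt := st_tau_bounded S (JA _ MA).
  symmetry; apply: adj_eq => x y.
  rewrite /second_leg e (tau_adj vM1 vM2 stoPhis S (JA _ MA)) /=.
  rewrite -[y in LHS](antiadjK antiJh) -[x in RHS](antiadjK antiJh).
  by rewrite /Ji !(anti_dot antiJi) (adjPr bt).
have dS : norm_dense [set Ji s | s in tensor_sums S].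
  move=> x e e0; have [s Ss hs] := tensor_sums_dense S (Jh x) e0.
  exists (Ji s); first by exists s.
  by rewrite -[x](antiadjK antiJh) -/Ji -(antiB antiJi) (anti_nrm antiJi).
apply: (dilation_preserving_markov vM1 st_algebra_vna sep1 separating_Om bV
  (stV_isometry vM1 vM2 stoPhis S) erefl VRV lin_leg id_leg second_leg_in M_leg
  adj_leg dS) => [_ _ [v Sv <-] [w Sw <-]|A MA]; last exact: second_leg_V.
have [C hC] := tau_le vM1 vM2 stoPhis Sv Sw.
exists C => A MA cA; rewrite /second_leg /= /Ji antiadjKr//.
rewrite /rdot (anti_dot antiJi) -/(rdot _ _) rdotC; apply: hC; first exact: JA.
by move=> h /=; rewrite (anti_nrm antiJ1) -[leRHS](anti_nrm antiJ1).
Qed.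

(** Both sides belong to [M2], so they are compared on [Om2], against the dense
    vectors [B Om2]; there the adjoint relation between [Phi] and [Phis] applies. *)
Lemma factorization A : M1 A -> Phi A = compression Lam (second_leg A).
Proof.
move=> MA; have RA := second_leg_in MA.
apply/eqP; rewrite eq_sym -subr_eq0; apply/eqP/sep2.
  by apply: vnaB => //; [exact: LRL|case: stoPhi => h _ _ _ _; apply: h].
apply: (norm_dense_ext dense2) => _ [B MB <-].
rewrite !fctE /rdot dotBr /compression /= -(adjP bLam) Lam_Om.
by rewrite -[Om]/(V Om1) second_leg_V// dot_Lam_V// subrr.
Qed.

End Factorization.

Theorem proposition4 (R : realType) (H1 H2 : hilbertType R)
  (M1 : set (H1 -> H1)) (Om1 : H1) (M2 : set (H2 -> H2)) (Om2 : H2)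
  (std1 : standard_form M1 Om1) (std2 : standard_form M2 Om2)
  (J1 : H1 -> H1) (J2 : H2 -> H2)
  (modJ1 : modular_conjugation M1 Om1 J1)
  (modJ2 : modular_conjugation M2 Om2 J2)
  (Phi : (H1 -> H1) -> (H2 -> H2)) (Phis : (H2 -> H2) -> (H1 -> H1))
  (stoPhi : stochastic M1 (vector_state Om1) M2 (vector_state Om2) Phi)
  (adjPhi :
    markov_adjoint M1 (vector_state Om1) M2 (vector_state Om2) Phi Phis)
  (L : hilbertType R) (S : stinespring M1 Om1 M2 Om2 Phis L)
  (Jh : L -> L) (Jh_antiunitary : antiunitary Jh)
  (JhV : Jh \o st_V S = st_V S \o J1)
  (VRV : forall T, st_algebra S Jh T -> M1 (adj (st_V S) \o T \o st_V S))
  (LRL : forall T, st_algebra S Jh T ->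
     M2 (adj (st_Lambda S) \o T \o st_Lambda S)) :
  standard_form (st_algebra S Jh) (st_Omega S) /\
  factorizable M1 (vector_state Om1) M2 (vector_state Om2) Phi.
Proof.
have std := standard_Om std1 std2 modJ1 adjPhi Jh_antiunitary JhV VRV LRL.
have [vR _ sepR nO] := std.
have [first1 first2 first3] := first_leg_markov std1 std2 stoPhi adjPhi
  Jh_antiunitary VRV LRL.
split=> //; exists L, (st_algebra S Jh), (vector_state (st_Omega S)).
exists (st_sigma S), (second_leg J1 S Jh), (compression (st_Lambda S)).
split=> //.
- by split=> //; apply: vector_state_normal_faithful.
- exact: (second_leg_markov std1 std2 modJ1 adjPhi Jh_antiunitary JhV VRV LRL).
- exact: (factorization std1 std2 modJ1 stoPhi adjPhi Jh_antiunitary JhV VRV LRL).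
Qed.
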